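(* Let $y(t,p)$ be the (scalar) random output of the linear dynamical system described in the context, with partial variances $V_1,\ldots,V_q$. Let the random variables be partitioned into $p=(a,b)$ with $a\in\Pi_a\subseteq\mathbb{R}^{q'}$ and $b\in\Pi_b\subseteq\mathbb{R}^{q-q'}$. For a constant $\bar{b}\in\Pi_b$ let $\bar{y}(t,p)=y(t,a,\bar{b})$. Then for each $\delta\in(0,1)$ there is a set $B_\delta\subset\Pi_b$ of probability larger than $1-\delta$ such that $$\left\| y-\bar{y}\right\|_{\mathcal{L}^2(\Pi\times[0,\infty))}^2 < \left(1+\tfrac{1}{\delta}\right)\sum_{j=q'+1}^{q}\|V_j\|_{\mathcal{L}^1([0,\infty))}$$ for all $\bar{b}\in B_\delta$.
   Context: System: for $p\in\Pi\subseteq\mathbb{R}^q$ consider $E(p)\dot{x}(t,p)=A(p)x(t,p)+B(p)u(t)$, $y(t,p)=C(p)x(t,p)$, $t\ge0$, with initial values $x(0,p)=x_0(p)$ and a given input $u:[0,\infty)\to\mathbb{R}^{n_{\rm in}}$, where $A(p),E(p)\in\mathbb{R}^{n\times n}$, $B(p)\in\mathbb{R}^{n\times n_{\rm in}}$, $C(p)\in\mathbb{R}^{1\times n}$ and $x_0(p)\in\mathbb{R}^n$ depend continuously on $p$, $E(p)$ is non-singular, and the system is asymptotically stable for each $p$ (all $\lambda\in\mathbb{C}$ with $\det(\lambda E(p)-A(p))=0$ have negative real part). Probability: the parameters $p=(p_1,\ldots,p_q)$ are independent random variables with joint probability density $\rho$ on $\Pi=\Pi_a\times\Pi_b$; $\mathbb{E}[f]=\int_\Pi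 f(p)\rho(p)\,{\rm d}p$, and $\mathcal{L}^2(\Pi)=\{f \text{ measurable}:\mathbb{E}[f^2]<\infty\}$ with $\langle f,g\rangle=\mathbb{E}[fg]$. The probability of a subset of $\Pi_b$ is with respect to the distribution of $b=(p_{q'+1},\ldots,p_q)$. It is assumed that $y(t,\cdot)\in\mathcal{L}^2(\Pi)$ for each $t\ge0$. Polynomial chaos and variances: $(\Phi_i)_{i\in\mathbb{N}}$ is a complete orthonormal system of $\mathcal{L}^2(\Pi)$ consisting of multivariate polynomials that are products of univariate orthonormal polynomials in $p_1,\ldots,p_q$, ordered by non-decreasing total degree, so $\Phi_1$ is the constant polynomial. Write $y(t,p)=\sum_{i=1}^\infty w_i(t)\Phi_i(p)$ (convergence in $\mathcal{L}^2(\Pi)$ pointwise in $t$), $w_i(t)=\langle y(t,\cdot),\Phi_i\rangle$. The partial variance associated to $p_j$ is $V_j(t)=\sum_{i\in\mathcal{I}_j}w_i(t)^2$, where $\mathcal{I}_j=\{i\in\mathbb{N}:\Phi_i\text{ is non-constant in }p_j\}$. The total variance is $V(t)=\sum_{i=2}^\infty w_i(t)^2$, and it is assumed that $V(t)>0$ for all $t>0$. Norms: $\|f\|_{\mathcal{L}^2(\Pi\times[0,\infty))}^2=\int_0^\infty\int_\Pi f(t,p)^2\rho(p)\,{\rm d}p\,{\rm d}t$ and $\|g\|_{\mathcal{L}^1([0,\infty))}=\int_0^\infty|g(t)|\,{\rm d}t$.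
   Formalization: With S the sum of the norms of V_j over j>q', the bound is proved with ≤ always, and with the strict < only if 0<S<∞ and the probability that equality holds is not exactly δ; in the excluded cases (e.g. y independent of b, where both sides are 0) the strict claim is false. *)

(* Defs.v *)
From HB Require Import structures.
From mathcomp Require Import all_boot all_order all_algebra.
From mathcomp Require Import complex.
From mathcomp Require Import all_classical all_reals all_analysis.

Set Implicit Arguments.
Unset Strict Implicit.
Unset Printing Implicit Defensive.

Import Order.TTheory GRing.Theory Num.Theory.
Import numFieldNormedType.Exports.

Local Open Scope classical_set_scope.
Local Open Scope ring_scope.

(* Tuples carry the product (Borel) sigma-algebra. *)
Notation Rpoint R n := (n.-tuple (measurableTypeR R)).

Section lebesgue_tuple.
Context (R : realType).

Definition cons_point (n : nat) (z : measurableTypeR R * Rpoint R n) :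
  Rpoint R n.+1 := [the n.+1.-tuple _ of z.1 :: z.2].

Lemma measurable_cons_point (n : nat) :
  measurable_fun [set: measurableTypeR R * Rpoint R n] (@cons_point n).
Proof. exact: measurable_cons. Qed.

Definition lebesgue_cons (n : nat)
    (m : {sigma_finite_measure set (Rpoint R n) -> \bar R}) :
    set (Rpoint R n.+1) -> \bar R :=
  pushforward (@lebesgue_measure R \x m)%E (@cons_point n).

Let lebesgue_cons0 n m : @lebesgue_cons n m set0 = 0%E.
Proof. by rewrite /lebesgue_cons /pushforward preimage_set0 measure0. Qed.

Let lebesgue_cons_ge0 n m A : (0 <= @lebesgue_cons n m A)%E.
Proof. by rewrite /lebesgue_cons /pushforward; exact: measure_ge0. Qed.

Let lebesgue_cons_sigma_additive n m :
  semi_sigma_additive (@lebesgue_cons n m).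
Proof.
have mc (A : set (Rpoint R n.+1)) :
    measurable A -> measurable (@cons_point n @^-1` A).
  by move=> mA; rewrite -[X in measurable X]setTI; exact: measurable_cons_point.
move=> F mF tF mUF; rewrite /lebesgue_cons /pushforward preimage_bigcup.
apply: measure_semi_sigma_additive => [i||]; first exact: mc.
- apply/trivIsetP => /= i j _ _ ij; rewrite -preimage_setI.
  by move/trivIsetP : tF => /(_ _ _ _ _ ij) ->//; rewrite preimage_set0.
- by rewrite -preimage_bigcup; exact: mc.
Qed.

HB.instance Definition _ n m := isMeasure.Build _ _ _ (@lebesgue_cons n m)
  (@lebesgue_cons0 n m) (@lebesgue_cons_ge0 n m)
  (@lebesgue_cons_sigma_additive n m).

Lemma lebesgue_cons_sigma_finite n m : sigma_finite setT (@lebesgue_cons n m).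
Proof.
pose g (v : Rpoint R n.+1) : measurableTypeR R * Rpoint R n :=
  (thead v, [tuple of behead v]).
have gK : cancel (@cons_point n) g.
  by case=> a v; rewrite /g /= theadE; congr pair; exact/val_inj.
have mg : measurable_fun setT g.
  apply/measurable_fun_pairP; split; first exact: measurable_tnth.
  exact: measurable_behead.
have /sigma_finiteP[F [TF ndF Foo]] := sigma_finiteT (@lebesgue_measure R).
have /sigma_finiteP[G [TG ndG Goo]] := sigma_finiteT m.
exists (fun i => g @^-1` (F i `*` G i)).
  apply/esym; rewrite -subTset => v _.
  have [i _ Fi] : (\bigcup_i F i) (g v).1 by rewrite -TF.
  have [j _ Gj] : (\bigcup_i G i) (g v).2 by rewrite -TG.
  exists (maxn i j) => //; split.
    by move: Fi; exact/subsetPset/ndF/leq_maxl.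
  by move: Gj; exact/subsetPset/ndG/leq_maxr.
move=> i; have [mFi Fi] := Foo i; have [mGi Gi] := Goo i; split.
  by rewrite -[X in measurable X]setTI; apply: mg => //; exact: measurableX.
rewrite /lebesgue_cons /pushforward -comp_preimage.
rewrite (_ : g \o _ = id); last by apply/funext => z; exact: gK.
by rewrite preimage_id product_measure1E// lte_mul_pinfty// ge0_fin_numE.
Qed.

HB.instance Definition _ n m := Measure_isSigmaFinite.Build _ _ _
  (@lebesgue_cons n m) (@lebesgue_cons_sigma_finite n m).

(* Lebesgue measure on R^n, as an iterated product of [lebesgue_measure]. *)
Fixpoint lebesgue_tuple (n : nat) :
    {sigma_finite_measure set (Rpoint R n) -> \bar R} :=
  match n with
  | 0 => \d_[tuple]
  | n'.+1 => lebesgue_cons (lebesgue_tuple n')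
  end.

End lebesgue_tuple.

Section parameters.
Context (R : realType).

(* Continuity is stated on row vectors, tuples carrying no topology. *)
Definition point_of_row (q : nat) (v : 'rV[R]_q) : Rpoint R q :=
  [tuple v ord0 i | i < q].

Definition continuous_on (q : nat) (Pi : set (Rpoint R q))
    (T : topologicalType) (F : Rpoint R q -> T) : Prop :=
  {within [set v | Pi (point_of_row v)], continuous (F \o @point_of_row q)}.

Definition a_part (q1 q2 : nat) (p : Rpoint R (q1 + q2)) : Rpoint R q1 :=
  [tuple tnth p (lshift q2 i) | i < q1].

Definition b_part (q1 q2 : nat) (p : Rpoint R (q1 + q2)) : Rpoint R q2 :=
  [tuple tnth p (rshift q1 i) | i < q2].

Definition join_parts (q1 q2 : nat) (a : Rpoint R q1) (b : Rpoint R q2) :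
  Rpoint R (q1 + q2) := [tuple of a ++ b].

Definition domain_prod (q1 q2 : nat) (Pia : set (Rpoint R q1))
    (Pib : set (Rpoint R q2)) : set (Rpoint R (q1 + q2)) :=
  [set p | Pia (a_part p) /\ Pib (b_part p)].

End parameters.

Section linear_system.
Context (R : realType).

Definition asymptotically_stable (n : nat) (E A : 'M[R]_n) : Prop :=
  forall z : R[i],
    \det (z *: map_mx (real_complex R) E - map_mx (real_complex R) A) = 0 ->
    complex.Re z < 0.

(* Derivative along [0, +oo[, hence one-sided at the time 0. *)
Definition has_time_derivative (n : nat) (x : R -> 'cV[R]_n) (t : R)
    (d : 'cV[R]_n) : Prop :=
  (h^-1 *: (x (t + h) - x t)) @[h --> within [set h | 0 <= t + h] 0^'] --> d.

Definition is_solution (n nin : nat) (E A : 'M[R]_n) (B : 'M[R]_(n, nin))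
    (u : R -> 'cV[R]_nin) (x0 : 'cV[R]_n) (x : R -> 'cV[R]_n) : Prop :=
  x 0 = x0 /\
  forall t : R, 0 <= t -> exists2 dx : 'cV[R]_n,
    has_time_derivative x t dx & E *m dx = A *m x t + B *m u t.

End linear_system.

Section probability_on_domain.
Context (R : realType) (q : nat).
Variables (Pi : set (Rpoint R q)) (rho : Rpoint R q -> R).
Implicit Types (f g : Rpoint R q -> R).

Definition prob (A : set (Rpoint R q)) : \bar R :=
  (\int[lebesgue_tuple R q]_(p in Pi `&` A) (rho p)%:E)%E.

Definition is_density : Prop :=
  [/\ measurable_fun Pi rho, forall p, Pi p -> 0 <= rho p & prob setT = 1%E].

Definition independent_coordinates : Prop :=
  forall (J : {set 'I_q}) (A : 'I_q -> set (measurableTypeR R)),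
    (forall j, measurable (A j)) ->
    prob [set p | forall j, j \in J -> A j (tnth p j)] =
    (\prod_(j in J) prob [set p | A j (tnth p j)])%E.

Definition sq_norm f : \bar R :=
  (\int[lebesgue_tuple R q]_(p in Pi) ((f p) ^+ 2 * rho p)%:E)%E.

Definition in_L2 f : Prop := measurable_fun Pi f /\ (sq_norm f < +oo)%E.

Definition inner f g : R :=
  \int[lebesgue_tuple R q]_(p in Pi) (f p * g p * rho p).

Definition complete_orthonormal (Phi : nat -> Rpoint R q -> R) : Prop :=
  [/\ forall i, in_L2 (Phi i),
      forall i k, inner (Phi i) (Phi k) = (i == k)%:R &
      forall f, in_L2 f ->
        sq_norm (fun p => f p - \sum_(i < N) inner f (Phi i) * Phi i p)
          @[N --> \oo] --> 0%E].

(* [phi j k] is the orthonormal polynomial of degree k in the variable p_j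
   (recall that [size] is the degree plus one), and [deg i j] is the degree of
   the i-th basis polynomial in p_j. The indexing starts at 0. *)
Definition polynomial_chaos (Phi : nat -> Rpoint R q -> R) : Prop :=
  complete_orthonormal Phi /\
  exists (phi : 'I_q -> nat -> {poly R}) (deg : nat -> 'I_q -> nat),
    [/\ forall j k, size (phi j k) = k.+1,
        forall j k l, inner (fun p => (phi j k).[tnth p j])
                            (fun p => (phi j l).[tnth p j]) = (k == l)%:R,
        forall i p, Phi i p = \prod_(j < q) (phi j (deg i j)).[tnth p j] &
        forall i k, (i <= k)%N ->
          (\sum_(j < q) deg i j <= \sum_(j < q) deg k j)%N].

Definition set_coord (p : Rpoint R q) (j : 'I_q) (r : R) : Rpoint R q :=
  [tuple if i == j then r else tnth p i | i < q].

Definition nonconstant_in (F : Rpoint R q -> R) (j : 'I_q) : Prop :=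
  exists p r, F (set_coord p j r) <> F p.

Variables (y : R -> Rpoint R q -> R) (Phi : nat -> Rpoint R q -> R).

Definition coef (t : R) (i : nat) : R := inner (y t) (Phi i).

Definition partial_variance (j : 'I_q) (t : R) : \bar R :=
  (\esum_(i in [set i | nonconstant_in (Phi i) j]) ((coef t i) ^+ 2)%:E)%E.

(* Since the indexing starts at 0, only the constant Phi 0 is left out. *)
Definition total_variance (t : R) : \bar R :=
  (\esum_(i in [set i | (0 < i)%N]) ((coef t i) ^+ 2)%:E)%E.

Definition sq_norm_time (f : R -> Rpoint R q -> R) : \bar R :=
  (\int[@lebesgue_measure R]_(t in `[0%R, +oo[) sq_norm (f t))%E.

End probability_on_domain.

Definition L1_norm_time (R : realType) (g : R -> \bar R) : \bar R :=
  (\int[@lebesgue_measure R]_(t in `[0%R, +oo[) `| g t |)%E.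

Section freezing.
Context (R : realType) (q1 q2 : nat).

Definition prob_b (Pi : set (Rpoint R (q1 + q2)))
    (rho : Rpoint R (q1 + q2) -> R) (A : set (Rpoint R q2)) : \bar R :=
  prob Pi rho [set p | A (b_part p)].

Definition freeze_b (y : R -> Rpoint R (q1 + q2) -> R) (bbar : Rpoint R q2) :
    R -> Rpoint R (q1 + q2) -> R :=
  fun t p => y t (join_parts (a_part p) bbar).

Definition freezing_error (Pi : set (Rpoint R (q1 + q2)))
    (rho : Rpoint R (q1 + q2) -> R) (y : R -> Rpoint R (q1 + q2) -> R)
    (bbar : Rpoint R q2) : \bar R :=
  sq_norm_time Pi rho (fun t p => y t p - freeze_b y bbar t p).

Definition sum_b_variances (Pi : set (Rpoint R (q1 + q2)))
    (rho : Rpoint R (q1 + q2) -> R) (y : R -> Rpoint R (q1 + q2) -> R)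
    (Phi : nat -> Rpoint R (q1 + q2) -> R) : \bar R :=
  (\sum_(j < q2)
     L1_norm_time (partial_variance Pi rho y Phi (rshift q1 j)))%E.

End freezing.

(* Main.v *)
Require Import Defs.
From HB Require Import structures.
From mathcomp Require Import all_boot all_order all_algebra.
From mathcomp Require Import complex.
From mathcomp Require Import all_classical all_reals all_analysis.
From mathcomp Require Import measurable_realfun.
From mathcomp Require Import ring lra.

(** Extend the output by zero to F(x, b) with x = (t, a).  By independence the
    law of (a, b) is the product of the laws of a and b.  With
    M(x) = E_b F(x, b), the decomposition
    E_b (F(x, b) - c)^2 = E_b (F(x, b) - M(x))^2 + (M(x) - c)^2 at
    c = F(x, b') integrates over x to  err(b') = T + Z(b'), where
    T = int_x E_b (F - M)^2 and Z(b') = int_x (M(x) - F(x, b'))^2, and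
    E_b Z = T by Tonelli.  Markov's inequality for Z then bounds err by
    (1 + 1/delta) T outside an event of probability at most delta, and its
    equality case decides whether the bounds are strict.

    It remains to see that T is at most the sum S of the norms of the partial
    variances.  At a fixed time, M minimises the mean square distance to y among
    the functions of a; the part of the N-th partial sum of the chaos expansion
    made of the Phi_i constant in b is such a function, and by orthonormality
    its squared distance to y exceeds that of the full partial sum, which tends
    to 0, by the sum of w_i^2 over the remaining i < N.  The differential
    equation only serves to make y continuous in t, hence jointly measurable. *)

Set Implicit Arguments.
Unset Strict Implicit.
Unset Printing Implicit Defensive.

Import Order.TTheory GRing.Theory Num.Theory.
Import numFieldNormedType.Exports.

Local Open Scope classical_set_scope.
Local Open Scope ring_scope.

(** * Strict Markov bound for a frozen variable *)

Section variance.
Context d (T : measurableType d) (R : realType) (P : probability T R).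
Variables (g : T -> R) (mg : measurable_fun setT g).
Local Open Scope ereal_scope.

Lemma measurable_sqrB c : measurable_fun setT (fun x => ((g x - c) ^+ 2)%:E).
Proof.
apply/measurable_EFinP; apply: measurable_funX.
exact: measurable_funB.
Qed.

(** With [u = g - b] and [v = b - c], the difference [2 u^2 + 2 v^2 - (u + v)^2 = (u - v)^2] is
    non-negative. *)
Lemma integral_sqrB_lty b c :
  \int[P]_x ((g x - b) ^+ 2)%:E < +oo -> \int[P]_x ((g x - c) ^+ 2)%:E < +oo.
Proof.
move=> H.
apply: (@le_lt_trans _ _
  (\int[P]_x (2%:E * ((g x - b) ^+ 2)%:E + (2 * (b - c) ^+ 2)%:E))).
  apply: ge0_le_integral => //.
  - by move=> x _; rewrite lee_fin sqr_ge0.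
  - exact: measurable_sqrB.
  - apply: emeasurable_funD => //; apply: emeasurable_funM => //.
    exact: measurable_sqrB.
  - move=> x _; rewrite -EFinM -EFinD lee_fin -subr_ge0.
    rewrite [leRHS](_ : _ = ((g x - b) - (b - c)) ^+ 2)%R ?sqr_ge0//.
    by ring.
rewrite ge0_integralD//; last 3 first.
- by move=> x _; rewrite mule_ge0// lee_fin sqr_ge0.
- apply: emeasurable_funM => //.
  exact: measurable_sqrB.
- by move=> x _; rewrite lee_fin mulr_ge0// sqr_ge0.
rewrite ge0_integralZl_EFin//; last 2 first.
- by move=> x _; rewrite lee_fin sqr_ge0.
- exact: measurable_sqrB.
rewrite integral_cst//= probability_setT mule1 lte_add_pinfty ?ltry//.
by rewrite lte_mul_pinfty.
Qed.

(* If g is not square integrable, then both sides are +oo, whatever the junk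
   value of m. *)
Lemma integral_sqrB_decomp c (m := (\int[P]_x g x)%R) :
  \int[P]_x ((g x - c) ^+ 2)%:E =
  \int[P]_x ((g x - m) ^+ 2)%:E + ((m - c) ^+ 2)%:E.
Proof.
have [goo|] := boolP (\int[P]_x ((g x - c) ^+ 2)%:E < +oo); last first.
  rewrite -leNgt leye_eq => /eqP cy; rewrite cy.
  have [/(@integral_sqrB_lty _ c)|] :=
    boolP (\int[P]_x ((g x - m) ^+ 2)%:E < +oo); first by rewrite cy.
  by rewrite -leNgt leye_eq => /eqP ->; rewrite addye.
have i2 : P.-integrable setT (fun x => ((g x - c) ^+ 2)%:E).
  apply/integrableP; split; first exact: measurable_sqrB.
  by under eq_integral => x _ do rewrite gee0_abs ?lee_fin ?sqr_ge0//.
have ic r : P.-integrable setT (fun x : T => r%:E).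
  exact: finite_measure_integrable_cst.
(* Domination by [|r| <= r^2 + 1], which follows from [(|r| - 1/2)^2 >= 0]. *)
have i1 : P.-integrable setT (fun x => (g x - c)%:E).
  apply: (@le_integrable _ _ _ _ _ _ _
    (fun x => ((g x - c) ^+ 2)%:E + 1%:E)) => //.
  - by apply/measurable_EFinP; exact: measurable_funB.
  - move=> x _; rewrite -EFinD !abse_EFin lee_fin.
    rewrite (ger0_norm (addr_ge0 (sqr_ge0 _) _))//.
    rewrite -[((g x - c) ^+ 2)%R]real_normK ?num_real//.
    have := sqr_ge0 (`|g x - c|%R - 2^-1)%R.
    by move: `|g x - c|%R => r; nra.
  - exact: integrableD.
have ig : P.-integrable setT (EFin \o g).
  apply: (eq_integrable _ (fun x => (g x - c)%:E + c%:E)) => //.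
    by move=> x _; rewrite -EFinD/= subrK.
  exact: integrableD.
have mE : m%:E = \int[P]_x (g x)%:E by rewrite fineK//; exact: integrable_fin_num.
have mcE : \int[P]_x (g x - c)%:E = (m - c)%:E.
  under eq_integral => x _ do rewrite EFinB.
  by rewrite integralB//= integral_cst//= probability_setT mule1 EFinB mE.
(* Expansion around [c]; the mixed term integrates to [-2 (m - c)^2]. *)
have -> : \int[P]_x ((g x - m) ^+ 2)%:E =
    \int[P]_x ((((g x - c) ^+ 2)%:E + (2 * (c - m))%:E * (g x - c)%:E) +
               ((c - m) ^+ 2)%:E).
  by apply: eq_integral => x _; rewrite -EFinM -!EFinD; congr EFin; ring.
have iZ : P.-integrable setT (fun x => (2 * (c - m))%:E * (g x - c)%:E).
  exact: integrableZl.
rewrite integralD//; last exact: integrableD.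
rewrite integralD// integralZl// mcE integral_cst//= probability_setT mule1.
rewrite -(@fineK _ (\int[P]_x ((g x - c) ^+ 2)%:E)); last first.
  exact: integrable_fin_num.
by rewrite -EFinM -!EFinD; congr EFin; ring.
Qed.

End variance.

(** * Markov's inequality and its equality case *)

Section markov.
Context d (T : measurableType d) (R : realType) (P : probability T R).
Variables (Z : T -> \bar R) (mZ : measurable_fun setT Z).
Hypothesis Z0 : forall x, (0 <= Z x)%E.
Local Open Scope ereal_scope.

Lemma measurable_superlevel c : measurable [set x | c <= Z x].
Proof. by rewrite -[X in measurable X]setTI; exact: emeasurable_fun_c_infty. Qed.

Lemma measurable_strict_superlevel c : measurable [set x | c < Z x].
Proof. by rewrite -[X in measurable X]setTI; exact: emeasurable_fun_o_infty. Qed.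

Lemma strict_superlevel0 : \int[P]_x Z x <= 0 -> P [set x | 0 < Z x] = 0.
Proof.
move=> Zle0; apply/negligibleP; first exact: measurable_strict_superlevel.
have : \int[P]_x `|Z x| = 0.
  under eq_integral => x _ do rewrite gee0_abs//.
  by apply/eqP; rewrite eq_le Zle0 integral_ge0.
move/(ae_eq_integral_abs P measurableT mZ); apply: negligibleS => x /= Zx ZE.
by move: Zx; rewrite ZE// ltxx.
Qed.

(** The integral of [Z] is at least its integral over [A], which is that of [Z - c] over [A] plus
    [c P(A)]. The assumed reverse of Markov's inequality makes the integral of [Z - c >= 0] over [A]
    vanish, so [Z = c] almost everywhere on [A]. *)
Lemma markov_eq (c : R) : (0 < c)%R ->
  \int[P]_x Z x <= c%:E * P [set x | c%:E <= Z x] ->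
  \int[P]_x Z x = c%:E * P [set x | c%:E <= Z x] /\ P [set x | c%:E < Z x] = 0.
Proof.
move=> c0; set A := [set x | c%:E <= Z x] => ZA.
have mA : measurable A := measurable_superlevel _.
have mZA : measurable_fun A Z by exact: measurable_funTS.
have Zc x : A x -> 0 <= Z x - c%:E by move=> Ax; rewrite sube_ge0.
have mZc : measurable_fun A (fun x => Z x - c%:E) by exact: emeasurable_funB.
have ZAle : \int[P]_(x in A) Z x <= \int[P]_x Z x.
  by apply: ge0_subset_integral.
have ZAE : \int[P]_(x in A) Z x =
    \int[P]_(x in A) (Z x - c%:E) + c%:E * P A.
  rewrite -integral_cst// -ge0_integralD//; last first.
    by move=> x _; rewrite lee_fin ltW.
  by apply: eq_integral => x _; rewrite subeK.
have PAfin : c%:E * P A \is a fin_num by rewrite fin_numM// fin_num_measure.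
have I0 : \int[P]_(x in A) (Z x - c%:E) = 0.
  apply/eqP; rewrite eq_le integral_ge0// andbT.
  by rewrite -(leeD2rE _ _ PAfin) add0e -ZAE (le_trans ZAle).
split.
  by apply/eqP; rewrite eq_le ZA/= (le_trans _ ZAle)// ZAE I0 add0e.
apply/negligibleP; first exact: measurable_strict_superlevel.
have : \int[P]_(x in A) `|Z x - c%:E| = 0.
  by rewrite -I0; apply: eq_integral => x /[!inE] Ax; rewrite gee0_abs// Zc.
move/(ae_eq_integral_abs P mA mZc); apply: negligibleS => x /= cZ ZE.
have /ZE ZxE : A x by exact: ltW.
by move: cZ; rewrite -sube_gt0 ZxE ltxx.
Qed.

(** For finite [S], [err x > bound] means [Z x > c] with [c = (1 + 1/delta) S - int Z], and
    [int Z <= S] gives [c >= S / delta]. If [S > 0], Markov bounds the probability of [{Z >= c}] by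
    [delta]; if it equals [delta], all of it sits on [{Z = c}], that is, on [{err = bound}].
    Discarding [{Z >= c}] yields strict bounds; when this would discard too much, only [{Z > c}] is
    discarded. *)
Lemma exists_markov_set (S : \bar R) (delta : R)
    (bound := (1 + delta^-1)%:E * S)
    (err := fun x => \int[P]_z Z z + Z x) :
  (0 < delta)%R -> (delta < 1)%R -> \int[P]_x Z x <= S ->
  exists B : set T, [/\ measurable B, (1 - delta)%:E < P B &
    forall x, B x -> err x <= bound /\
      (0 < S -> S < +oo -> P [set x | err x = bound] <> delta%:E ->
        err x < bound)].
Proof.
move=> d0 d1 ZS.
have k0 : (0 < 1 + delta^-1)%R by rewrite addr_gt0// invr_gt0.
have I0 : 0 <= \int[P]_x Z x by exact: integral_ge0.
have S0 : 0 <= S by exact: le_trans ZS.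
have largeC (A : set T) : measurable A -> P A < delta%:E ->
    (1 - delta)%:E < P (~` A).
  move=> mA; rewrite probability_setC// -(fineK (fin_num_measure P A mA)).
  by rewrite !lte_fin; lra.
(* An infinite [S] makes [bound] infinite: the whole space works, and the clause on strictness is
   void. *)
have [Sy|Soo] := eqVneq S +oo.
  exists setT; split => //; first by rewrite probability_setT lte_fin; lra.
  have -> : bound = +oo by rewrite /bound Sy gt0_muley// lte_fin.
  by move=> x _; split; [rewrite leey|rewrite Sy ltxx].
have Sfin : S \is a fin_num by rewrite ge0_fin_numE// ltey.
have [s SE] : exists s, S = s%:E by exists (fine S); rewrite fineK.
have s0 : (0 <= s)%R by rewrite -lee_fin -SE.
have Ifin : \int[P]_x Z x \is a fin_num.
  by rewrite ge0_fin_numE//; apply: le_lt_trans ZS _; rewrite ltey.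
have [t IE] : exists t, \int[P]_x Z x = t%:E.
  by exists (fine (\int[P]_x Z x)); rewrite fineK.
have ts : (t <= s)%R by rewrite -lee_fin -SE -IE.
pose c := ((1 + delta^-1) * s - t)%R.
have cs : (s / delta <= c)%R by rewrite /c mulrDl mul1r mulrC; lra.
have errlt x : (err x < bound) = (Z x < c%:E).
  by rewrite /err /bound SE IE -EFinM EFinB lteBrDl.
have errge x : (bound <= err x) = (c%:E <= Z x).
  by rewrite /err /bound SE IE -EFinM EFinB leeBlDl.
have errgt x : (bound < err x) = (c%:E < Z x).
  by rewrite /err /bound SE IE -EFinM EFinB lteBlDl.
have errle x : (err x <= bound) = (Z x <= c%:E).
  by rewrite /err /bound SE IE -EFinM EFinB leeBrDl.
(* If [p >= delta], then [int Z <= s <= c delta <= c p] is the reverse of Markov's inequality. The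
   resulting equality [int Z = c p], together with [int Z <= c delta], gives [p = delta]. *)
have tail : (0 < s)%R -> delta%:E <= P [set x | c%:E <= Z x] ->
    P [set x | c%:E < Z x] = 0 /\ P [set x | c%:E <= Z x] = delta%:E.
  move=> sp; set p := P _ => dp.
  have pfin : p \is a fin_num.
    by rewrite fin_num_measure//; exact: measurable_superlevel.
  have sd : (0 < s / delta)%R by rewrite divr_gt0.
  have c0 : (0 < c)%R by exact: lt_le_trans cs.
  have scd : (s <= c * delta)%R by rewrite -ler_pdivrMr.
  have Icp : \int[P]_x Z x <= c%:E * p.
    rewrite IE -(fineK pfin) -EFinM lee_fin (le_trans ts)// (le_trans scd)//.
    by rewrite ler_pM2l// -lee_fin fineK.
  have [IpE ->] := markov_eq c0 Icp; split=> //.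
  move: IpE; rewrite IE -/p -(fineK pfin) -EFinM => -[tE]; congr EFin.
  have dp' : (delta <= fine p)%R by rewrite -lee_fin fineK.
  apply/eqP; rewrite eq_le dp' andbT -(ler_pM2l c0) -tE.
  exact: le_trans scd.
pose A := [set x | c%:E < Z x]; pose A1 := [set x | c%:E <= Z x].
have mA : measurable A := measurable_strict_superlevel _.
have mA1 : measurable A1 := measurable_superlevel _.
(* The first case collects the premises of the strict clause, which is therefore vacuous in the
   second. *)
have [[sp Hd]|H] := pselect ((0 < s)%R /\ P [set x | err x = bound] <> delta%:E).
  exists (~` A1); split; first exact: measurableC.
    apply: largeC => //; rewrite ltNge; apply/negP => /(tail sp)[PA PA1].
    (* The difference of the two superlevel sets is [{err = bound}]; it would have probability
       [delta], against [Hd]. *)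
    have DE : P A1 = P (A1 `\` A) + P (A1 `&` A) := measureDI P mA1 mA.
    have A1A : A1 `&` A = A.
      by apply/seteqP; split=> [x []//|x Ax]; split=> //; exact: ltW.
    have PA0 : P A = 0 := PA.
    apply: Hd; rewrite -PA1 -/A1 DE A1A PA0 adde0.
    congr (P _); apply/seteqP; split=> x.
      move=> /= xE; rewrite /A1 /A /= -errge -errgt.
      by split; rewrite xE ?ltxx.
    rewrite /A1 /A /= -errge -errgt => -[h1 /negP]; rewrite -leNgt => h2.
    by apply/eqP; rewrite eq_le h1 h2.
  by move=> x /= /negP; rewrite -ltNge -errlt => h; split=> //; exact: ltW.
exists (~` A); split; first exact: measurableC.
  apply: largeC => //.
  (* For [s > 0] a probability of at least [delta] contradicts [tail]. For [s = 0] also [t = c = 0],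
     and [Z] vanishes almost everywhere. *)
  have [sp|] := ltP 0%R s.
    rewrite ltNge; apply/negP => dA.
    have : delta%:E <= P A1.
      by rewrite (le_trans dA)// le_measure ?inE// => x /= /ltW.
    move=> /(tail sp)[PA _]; move: dA; rewrite PA lee_fin.
    by rewrite leNgt d0.
  move=> s0'; have sE : s = 0%R by apply/eqP; rewrite eq_le s0' s0.
  have tE : t = 0%R.
    by apply/eqP; rewrite eq_le -{1}sE ts -lee_fin -IE.
  have cE : c = 0%R by rewrite /c sE tE mulr0 subr0.
  by rewrite /A cE strict_superlevel0 ?lte_fin// IE tE.
move=> x /= /negP; rewrite -leNgt -errle => h; split=> //.
by rewrite SE lte_fin => sp _ Hd; exfalso; exact: H.
Qed.

End markov.

(** * Measurability of integrals depending on a parameter *)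

Section parametric_integral.
Context d1 d2 (X : measurableType d1) (Y : measurableType d2) (R : realType).
Variable m : {sigma_finite_measure set Y -> \bar R}.
Local Open Scope ereal_scope.

(** The integral is the difference of those of the positive and negative parts, and Tonelli's
    theorem makes each of them measurable in [x], even where [f (x, -)] is not integrable. *)
Lemma measurable_parametric_integral (f : X * Y -> \bar R) :
  measurable_fun setT f ->
  measurable_fun setT (fun x => \int[m]_y f (x, y)).
Proof.
move=> mf.
have -> : (fun x => \int[m]_y f (x, y)) =
    (fun x => fubini_F m f^\+ x - fubini_F m f^\- x).
  apply/funext => x; rewrite integralE; congr (_ - _).
    by apply: eq_integral => y _; rewrite !funeposE.
  by apply: eq_integral => y _; rewrite !funenegE.
apply: emeasurable_funB.
- by apply: measurable_fun_fubini_tonelli_F => //; exact: measurable_funepos.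
- by apply: measurable_fun_fubini_tonelli_F => //; exact: measurable_funeneg.
Qed.

Lemma measurable_parametric_Rintegral (f : X * Y -> R) :
  measurable_fun setT f ->
  measurable_fun setT (fun x => \int[m]_y f (x, y))%R.
Proof.
move=> mf; apply: measurableT_comp => //.
apply: (@measurable_parametric_integral (EFin \o f)).
exact/measurable_EFinP.
Qed.

End parametric_integral.

Section freezing.
Context d1 d2 (X : measurableType d1) (Y : measurableType d2) (R : realType).
Variables (nu : {sigma_finite_measure set X -> \bar R}) (P : probability Y R).
Variables (F : X * Y -> R) (mF : measurable_fun setT F).
Local Open Scope ereal_scope.

Let M x := (\int[P]_b F (x, b))%R.

(** The quantity T of the overview. *)
Definition mean_sq_dev : \bar R :=
  \int[nu]_x \int[P]_b ((F (x, b) - M x) ^+ 2)%:E.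

(** The quantity err(b') of the overview, the pair (t, a) being abstracted to a point of [X]. *)
Definition frozen_sq_dev b' : \bar R :=
  \int[nu]_x \int[P]_b ((F (x, b) - F (x, b')) ^+ 2)%:E.

Let G (z : X * Y) : \bar R := ((F z - M z.1) ^+ 2)%:E.

Let mG : measurable_fun setT G.
Proof.
apply/measurable_EFinP; apply: measurable_funX; apply: measurable_funB => //.
apply: (measurableT_comp (f := M)) => //.
exact: measurable_parametric_Rintegral.
Qed.

Let G0 z : 0 <= G z. Proof. by rewrite lee_fin sqr_ge0. Qed.

Let Z b := \int[nu]_x G (x, b).

(** The decomposition [integral_sqrB_decomp] at [c = F (x, b)], integrated over [x]. *)
Let frozen_sq_devE b : frozen_sq_dev b = mean_sq_dev + Z b.
Proof.
rewrite /frozen_sq_dev /mean_sq_dev /Z.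
under eq_integral => x _.
  rewrite (integral_sqrB_decomp P (g := fun b => F (x, b))); last first.
    exact: measurableT_comp.
  rewrite -[((_ - F _) ^+ 2)%R]sqrrN opprB -/(M x) -/(G (x, b)).
  over.
rewrite ge0_integralD//.
- by move=> x _; apply: integral_ge0 => c _; rewrite lee_fin sqr_ge0.
- exact: (@measurable_fun_fubini_tonelli_F _ _ _ _ _ P G).
- exact: measurableT_comp.
Qed.

Let integral_Z : \int[P]_b Z b = mean_sq_dev.
Proof. by rewrite /Z -(fubini_tonelli (m1 := nu) (m2 := P) G). Qed.

Lemma exists_frozen_set (S : \bar R) (delta : R)
    (bound := (1 + delta^-1)%:E * S) :
  (0 < delta)%R -> (delta < 1)%R -> mean_sq_dev <= S ->
  exists B : set Y, [/\ measurable B, (1 - delta)%:E < P B &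
    forall b, B b -> frozen_sq_dev b <= bound /\
      (0 < S -> S < +oo -> P [set b' | frozen_sq_dev b' = bound] <> delta%:E ->
        frozen_sq_dev b < bound)].
Proof.
move=> delta0 delta1 TS.
have mZ : measurable_fun setT Z.
  exact: (@measurable_fun_fubini_tonelli_G _ _ _ _ _ nu G).
have Z0 b : 0 <= Z b by exact: integral_ge0.
rewrite -integral_Z in TS.
have [B [mB PB HB]] := exists_markov_set mZ Z0 delta0 delta1 TS.
exists B; split=> // b /HB; rewrite frozen_sq_devE -integral_Z => -[h1 h2].
split=> // S0 Soo; under eq_set do rewrite frozen_sq_devE -integral_Z.
exact: h2.
Qed.

End freezing.

(** * Laws given by densities, product laws *)

Section density.
Context d (T : measurableType d) (R : realType).
Variables (la : {sigma_finite_measure set T -> \bar R}) (r : T -> R).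
Hypotheses (mr : measurable_fun setT r) (r0 : forall x, 0 <= r x).
Local Open Scope ereal_scope.

Let nu A := \int[la]_(x in A) (r x)%:E.

(** The integration formula comes from the change of variables for Radon-Nikodym derivatives: the
    derivative of [P] and [r] have the same integral over every measurable set, so they agree almost
    everywhere. *)
Lemma density_probability : nu setT = 1 ->
  exists2 P : probability T R, (forall A, P A = \int[la]_(x in A) (r x)%:E) &
    forall g : T -> \bar R, measurable_fun setT g -> (forall x, 0 <= g x) ->
      \int[P]_x g x = \int[la]_x (g x * (r x)%:E).
Proof.
move=> nuT.
have mEr : measurable_fun setT (EFin \o r) by exact/measurable_EFinP.
have nu0 : nu set0 = 0 by rewrite /nu integral_set0.
have nu_ge0 A : 0 <= nu A by apply: integral_ge0 => x _; rewrite lee_fin.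
have nu_sigma : semi_sigma_additive nu.
  move=> /= F mF tF mUF; rewrite /nu; apply: cvg_toP.
    apply: ereal_nondecreasing_is_cvgn => m n mn.
    apply: lee_sum_nneg_natr => // k _ _.
    by apply: integral_ge0 => /= x Fkx; rewrite lee_fin.
  rewrite ge0_integral_bigcup//=; first exact: measurable_funTS.
  by move=> x _; rewrite lee_fin.
pose numu := isMeasure.Build _ _ _ nu nu0 nu_ge0 nu_sigma.
pose mnu : {measure set T -> \bar R} := HB.pack nu numu.
pose pnu := Measure_isProbability.Build _ _ R mnu nuT.
pose P : probability T R := HB.pack nu numu pnu.
exists P => // g mg g0.
have ir : la.-integrable setT (EFin \o r).
  apply/integrableP; split=> //.
  by under eq_integral => x _ do rewrite gee0_abs ?lee_fin//; rewrite -/(nu _) nuT ltry.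
have Pla : P `<< la.
  apply/null_content_dominatesP => A mA A0.
  by apply: null_set_integral => //; exact: measurable_funTS.
rewrite -(Radon_Nikodym_SigmaFinite.change_of_variables Pla)//.
have iRN := Radon_Nikodym_SigmaFinite.f_integrable Pla.
have mRN := measurable_int _ iRN.
apply: ge0_ae_eq_integral => //.
- exact: emeasurable_funM.
- exact: emeasurable_funM.
- move=> x _; rewrite mule_ge0//.
  exact: Radon_Nikodym_SigmaFinite.f_ge0.
- by move=> x _; rewrite mule_ge0// lee_fin.
- have : ae_eq la setT (Radon_Nikodym_SigmaFinite.f P la) (EFin \o r).
    apply: integral_ae_eq => // E _ mE.
    by rewrite -Radon_Nikodym_SigmaFinite.f_integral.
  by apply: filterS => x /= /[apply] ->.
Qed.

End density.

Section density_on_domain.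
Context (R : realType) (q : nat) (Pi : set (Rpoint R q)) (rho : Rpoint R q -> R).
Hypotheses (mPi : measurable Pi) (rho_density : is_density Pi rho).

(** Extending [rho] by zero outside [Pi] turns the law of the parameters into a probability on the
    whole space. *)
Lemma is_density_probability : exists2 P : probability (Rpoint R q) R,
  (forall A, prob Pi rho A = P A) &
  forall g : Rpoint R q -> \bar R, measurable_fun setT g ->
    (forall p, 0 <= g p)%E ->
    (\int[P]_p g p = \int[lebesgue_tuple R q]_(p in Pi) (g p * (rho p)%:E))%E.
Proof.
have [mrho rho0 rho1] := rho_density.
pose r := rho \_ Pi.
have mr : measurable_fun setT r by apply/(measurable_restrictT _ mPi).
have r0 p : 0 <= r p by rewrite /r patchE; case: ifPn => // /[!inE]; exact: rho0.
have probE A : prob Pi rho A = (\int[lebesgue_tuple R q]_(p in A) (r p)%:E)%E.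
  rewrite /prob setIC integral_mkcondr; apply: eq_integral => p _.
  by rewrite restrict_EFin.
have [P PE intP] := density_probability mr r0 (etrans (esym (probE _)) rho1).
exists P => [A|g mg g0]; first by rewrite PE probE.
rewrite intP// [RHS]integral_mkcond; apply: eq_integral => p _.
by rewrite /r !patchE; case: ifPn => // _; rewrite mule0.
Qed.

End density_on_domain.

Section tuple_measure.
Context d (T : measurableType d) (R : realType) (n : nat).

Definition rectangle (A : 'I_n -> set T) : set (n.-tuple T) :=
  [set t | forall i, A i (tnth t i)].

Lemma measurable_rectangle A : (forall i, measurable (A i)) ->
  measurable (rectangle A).
Proof.
move=> mA; have -> : rectangle A =
    \big[setI/setT]_(i < n) ((fun t => tnth t i) @^-1` A i).
  rewrite -bigcap_seq; apply/seteqP; split=> t /= tA i => [_|]; first exact: tA.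
  by apply: (tA i); rewrite /= mem_index_enum.
apply: bigsetI_measurable => i _.
rewrite -[X in measurable X]setTI; exact: measurable_tnth.
Qed.

(** Boxes are stable under intersection, generate the product sigma-algebra and include the whole
    space, so they determine a finite measure. *)
Lemma tuple_measure_unique (m1 m2 : {measure set (n.-tuple T) -> \bar R}) :
  (m1 setT < +oo)%E ->
  (forall A, (forall i, measurable (A i)) ->
    m1 (rectangle A) = m2 (rectangle A)) ->
  forall X, measurable X -> m1 X = m2 X.
Proof.
move=> m1T m12 X mX.
pose G := [set B | exists2 A : 'I_n -> set T,
  (forall i, measurable (A i)) & B = rectangle A].
apply: (measure_unique G (fun=> setT)) => //.
- apply/seteqP; split.
    apply: smallest_sub; first exact: smallest_sigma_algebra.
    rewrite -bigcup_seq => B [i _ [C mC <-]].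
    (* A coordinate cylinder is the box whose other sides are the whole space. *)
    apply: sub_sigma_algebra; exists (fun j => if j == i then C else setT).
      by move=> j; case: ifP.
    apply/seteqP; split=> t /= => [[_ tC] j|tC]; first by case: eqP => // ->.
    by split=> //; have := tC i; rewrite eqxx.
  apply: smallest_sub; first exact: sigma_algebra_measurable.
  by move=> _ [A mA ->]; exact: measurable_rectangle.
- move=> _ _ [A mA ->] [B mB ->]; exists (fun i => A i `&` B i).
    by move=> i; exact: measurableI.
  apply/seteqP; split=> t /= => [[tA tB] i|tAB]; first by split.
  by split=> i; have [] := tAB i.
- move=> _; exists (fun=> setT) => //.
  by apply/seteqP; split.
- by rewrite bigcup_const.
- by move=> _ [A mA ->]; exact: m12.
Qed.

End tuple_measure.

(** * Splitting a point into its parts a and b *)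

Section parts.
Context (R : realType) (q1 q2 : nat).

Lemma measurable_a_part : measurable_fun setT (@a_part R q1 q2).
Proof.
apply/measurable_fun_tnthP => i.
have -> : (@tnth _ _)^~ i \o @a_part R q1 q2 = (fun p => tnth p (lshift q2 i)).
  by apply/funext => p /=; rewrite tnth_mktuple.
exact: measurable_tnth.
Qed.

Lemma measurable_b_part : measurable_fun setT (@b_part R q1 q2).
Proof.
apply/measurable_fun_tnthP => i.
have -> : (@tnth _ _)^~ i \o @b_part R q1 q2 = (fun p => tnth p (rshift q1 i)).
  by apply/funext => p /=; rewrite tnth_mktuple.
exact: measurable_tnth.
Qed.

Lemma tnth_join_lshift (a : Rpoint R q1) (b : Rpoint R q2) i :
  tnth (join_parts a b) (lshift q2 i) = tnth a i.
Proof. by rewrite /join_parts tnth_lshift. Qed.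

Lemma tnth_join_rshift (a : Rpoint R q1) (b : Rpoint R q2) i :
  tnth (join_parts a b) (rshift q1 i) = tnth b i.
Proof. by rewrite /join_parts tnth_rshift. Qed.

Lemma measurable_join_parts : measurable_fun setT
  (fun z : Rpoint R q1 * Rpoint R q2 => join_parts z.1 z.2).
Proof.
apply/measurable_fun_tnthP => i; case: (split_ordP i) => j ->.
  have -> : (@tnth _ _)^~ (lshift q2 j) \o
    (fun z : Rpoint R q1 * Rpoint R q2 => join_parts z.1 z.2) =
    (fun p => tnth p j) \o fst.
    by apply/funext => z /=; rewrite tnth_join_lshift.
  by apply: measurableT_comp => //; exact: measurable_tnth.
have -> : (@tnth _ _)^~ (rshift q1 j) \o
  (fun z : Rpoint R q1 * Rpoint R q2 => join_parts z.1 z.2) =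
  (fun p => tnth p j) \o snd.
  by apply/funext => z /=; rewrite tnth_join_rshift.
by apply: measurableT_comp => //; exact: measurable_tnth.
Qed.

Lemma a_part_join (a : Rpoint R q1) (b : Rpoint R q2) :
  a_part (join_parts a b) = a.
Proof. by apply: eq_from_tnth => i; rewrite tnth_mktuple tnth_join_lshift. Qed.

Lemma b_part_join (a : Rpoint R q1) (b : Rpoint R q2) :
  b_part (join_parts a b) = b.
Proof. by apply: eq_from_tnth => i; rewrite tnth_mktuple tnth_join_rshift. Qed.

Lemma join_parts_ab (p : Rpoint R (q1 + q2)) :
  join_parts (a_part p) (b_part p) = p.
Proof.
apply: eq_from_tnth => i; case: (split_ordP i) => j ->.
  by rewrite tnth_join_lshift tnth_mktuple.
by rewrite tnth_join_rshift tnth_mktuple.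
Qed.

Lemma rectangle_join (A : 'I_(q1 + q2) -> set (measurableTypeR R)) :
  (fun z : Rpoint R q1 * Rpoint R q2 => join_parts z.1 z.2) @^-1` rectangle A =
  rectangle (fun i => A (lshift q2 i)) `*` rectangle (fun i => A (rshift q1 i)).
Proof.
apply/seteqP; split=> -[a b] /=.
  by move=> h; split=> i; [have := h (lshift q2 i)|have := h (rshift q1 i)];
    rewrite ?tnth_join_lshift ?tnth_join_rshift.
move=> [ha hb] i; case: (split_ordP i) => j ->.
  by rewrite tnth_join_lshift; exact: ha.
by rewrite tnth_join_rshift; exact: hb.
Qed.

End parts.

(** * Independence: the law of p is the product of the laws of a and b *)

Section product_law.
Context (R : realType) (q1 q2 : nat).

HB.instance Definition _ := isMeasurableFun.Build _ _ _ _
  (@a_part R q1 q2) (@measurable_a_part R q1 q2).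
HB.instance Definition _ := isMeasurableFun.Build _ _ _ _
  (@b_part R q1 q2) (@measurable_b_part R q1 q2).

Variable P : probability (Rpoint R (q1 + q2)) R.
Hypothesis P_rectangle : forall A : 'I_(q1 + q2) -> set (measurableTypeR R),
  (forall j, measurable (A j)) ->
  P (rectangle A) = (\prod_j P [set p | A j (tnth p j)])%E.

Definition law_a : probability (Rpoint R q1) R := distribution P (@a_part R q1 q2).
Definition law_b : probability (Rpoint R q2) R := distribution P (@b_part R q1 q2).
Local Open Scope ereal_scope.

(** The box is completed by whole lines in the b-coordinates, whose factors equal 1. *)
Lemma law_a_rectangle (A : 'I_q1 -> set (measurableTypeR R)) :
  (forall j, measurable (A j)) ->
  law_a (rectangle A) = \prod_j P [set p | A j (tnth p (lshift q2 j))].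
Proof.
move=> mA; pose A' (i : 'I_(q1 + q2)) := if fintype.split i is inl j then A j else setT.
have A'l j : A' (lshift q2 j) = A j by rewrite /A' (unsplitK (inl _)).
have A'r j : A' (rshift q1 j) = setT by rewrite /A' (unsplitK (inr _)).
transitivity (P (rectangle A')).
  congr (P _); apply/seteqP; split=> p /= h i.
    case: (split_ordP i) => j ->; last by rewrite A'r.
    by rewrite A'l; have := h j; rewrite tnth_mktuple.
  by rewrite tnth_mktuple -A'l; exact: h.
rewrite P_rectangle; last by move=> i; rewrite /A'; case: fintype.split.
rewrite big_split_ord/= [X in _ * X]big1 ?mule1; last first.
  by move=> i _; rewrite A'r -[RHS](probability_setT P).
by apply: eq_bigr => i _; rewrite A'l.
Qed.

Lemma law_b_rectangle (A : 'I_q2 -> set (measurableTypeR R)) :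
  (forall j, measurable (A j)) ->
  law_b (rectangle A) = \prod_j P [set p | A j (tnth p (rshift q1 j))].
Proof.
move=> mA; pose A' (i : 'I_(q1 + q2)) := if fintype.split i is inr j then A j else setT.
have A'l j : A' (lshift q2 j) = setT by rewrite /A' (unsplitK (inl _)).
have A'r j : A' (rshift q1 j) = A j by rewrite /A' (unsplitK (inr _)).
transitivity (P (rectangle A')).
  congr (P _); apply/seteqP; split=> p /= h i.
    case: (split_ordP i) => j ->; first by rewrite A'l.
    by rewrite A'r; have := h j; rewrite tnth_mktuple.
  by rewrite tnth_mktuple -A'r; exact: h.
rewrite P_rectangle; last by move=> i; rewrite /A'; case: fintype.split.
rewrite big_split_ord/= [X in X * _]big1 ?mul1e; last first.
  by move=> i _; rewrite A'l -[RHS](probability_setT P).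
by apply: eq_bigr => i _; rewrite A'r.
Qed.

Let join (z : Rpoint R q1 * Rpoint R q2) := join_parts z.1 z.2.

HB.instance Definition _ := isMeasurableFun.Build _ _ _ _
  join (@measurable_join_parts R q1 q2).

(** Both measures give a box the product of its marginal probabilities, and boxes determine a finite
    measure. *)
Lemma law_join X : measurable X ->
  P X = distribution (law_a \x law_b)%E join X.
Proof.
apply: tuple_measure_unique => [|A mA].
  by rewrite -ge0_fin_numE// fin_num_measure.
rewrite /distribution/= /pushforward rectangle_join.
rewrite [RHS]product_measure1E; [|exact: measurable_rectangle..].
rewrite P_rectangle// big_split_ord/=; congr (_ * _).
  by rewrite law_a_rectangle.
by rewrite law_b_rectangle.
Qed.

Lemma ge0_integral_parts (g : Rpoint R q1 * Rpoint R q2 -> \bar R) :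
  measurable_fun setT g -> (forall z, 0 <= g z) ->
  \int[P]_p g (a_part p, b_part p) = \int[law_a \x law_b]_z g z.
Proof.
move=> mg g0.
rewrite (eq_measure_integral (distribution (law_a \x law_b)%E join)); last first.
  by move=> A mA _; exact: law_join.
rewrite ge0_integral_distribution//; last first.
  apply: (measurableT_comp mg); apply/measurable_fun_pairP; split.
    exact: measurable_a_part.
  exact: measurable_b_part.
by apply: eq_integral => -[a b] _; rewrite /join/= a_part_join b_part_join.
Qed.

End product_law.

(** * Products of sigma-finite measures, for time paired with a *)

Section sigma_finite_product.
Context d1 d2 (T1 : measurableType d1) (T2 : measurableType d2) (R : realType).
Variables (m1 : {sigma_finite_measure set T1 -> \bar R})
  (m2 : {sigma_finite_measure set T2 -> \bar R}).
Local Open Scope ereal_scope.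

(* The canonical sigma-finite structure of [\x] is only inferred for products
   of (sub)probabilities, hence this alias. *)
Definition sigma_finite_product := m1 \x m2.

HB.instance Definition _ := Measure.copy sigma_finite_product (m1 \x m2).

Lemma sigma_finite_product_sigma_finite : sigma_finite setT sigma_finite_product.
Proof.
have /sigma_finiteP[A [TA ndA Afin]] := sigma_finiteT m1.
have /sigma_finiteP[B [TB ndB Bfin]] := sigma_finiteT m2.
exists (fun k => A k `*` B k) => [|k].
  apply/seteqP; split=> // -[x z] _.
  have [i _ Ax] : (\bigcup_i A i) x by rewrite -TA.
  have [j _ Bz] : (\bigcup_j B j) z by rewrite -TB.
  (* Both exhausting sequences increase, so the larger index serves both factors. *)
  exists (maxn i j) => //; split=> /=.
    by move: Ax; exact/subsetPset/ndA/leq_maxl.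
  by move: Bz; exact/subsetPset/ndB/leq_maxr.
have [mA Ak] := Afin k; have [mB Bk] := Bfin k.
split; first exact: measurableX.
by rewrite [ltLHS]product_measure1E// lte_mul_pinfty// ge0_fin_numE.
Qed.

HB.instance Definition _ := Measure_isSigmaFinite.Build _ _ _
  sigma_finite_product sigma_finite_product_sigma_finite.

Lemma ge0_integral_sigma_finite_product (f : T1 * T2 -> \bar R) :
  measurable_fun setT f -> (forall z, 0 <= f z) ->
  \int[sigma_finite_product]_z f z = \int[m1]_x \int[m2]_z f (x, z).
Proof. exact: fubini_tonelli1. Qed.

End sigma_finite_product.

(** * Joint measurability of the output *)

Section caratheodory.
Context d (T : measurableType d) (R : realType).
Variables (D : set T) (mD : measurable D) (y : R -> T -> R).
Hypothesis my : forall t : R, 0 <= t -> measurable_fun D (y t).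
Hypothesis cy : forall p, D p -> forall t : R, 0 <= t ->
  forall e : R, 0 < e ->
  exists2 r : R, 0 < r &
    forall s : R, 0 <= s -> `|t - s| < r -> `|y t p - y s p| < e.

Let E : set (measurableTypeR R * T) := `[0, +oo[ `*` D.

(** For [t >= 0], rounding down to the grid of mesh [1/(n+1)]. *)
Let step n (t : R) : R := (Num.truncn (t * n.+1%:R))%:R / n.+1%:R.

Let step_ge0 n t : 0 <= step n t.
Proof. by rewrite divr_ge0. Qed.

Let stepB n t : 0 <= t -> `|t - step n t| <= n.+1%:R^-1.
Proof.
move=> t0; have n0 : 0 < n.+1%:R :> R by rewrite ltr0n.
have /andP[h1 h2] : (Num.truncn (t * n.+1%:R))%:R <= t * n.+1%:R <
    (Num.truncn (t * n.+1%:R)).+1%:R by rewrite truncn_itv// mulr_ge0.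
rewrite ger0_norm; last by rewrite subr_ge0 /step ler_pdivrMr.
rewrite lerBlDr.
have -> : n.+1%:R^-1 + step n t = (Num.truncn (t * n.+1%:R)).+1%:R / n.+1%:R.
  by rewrite /step -[X in _ = X%:R / _]addn1 natrD mulrDl mul1r addrC.
by rewrite ler_pdivlMr// ltW.
Qed.

Let y_step n (z : measurableTypeR R * T) : R := y (step n z.1) z.2.

(** On each strip between consecutive grid times [y_step n] depends on [p] alone, so a preimage is a
    countable union of measurable rectangles. *)
Let measurable_y_step n : measurable_fun E (y_step n).
Proof.
move=> mE Y mY.
have n0 : 0 < n.+1%:R :> R by rewrite ltr0n.
have -> : E `&` y_step n @^-1` Y = \bigcup_k
    (`[k%:R / n.+1%:R, k.+1%:R / n.+1%:R[%classic `*`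
     (D `&` y (k%:R / n.+1%:R) @^-1` Y)).
  apply/seteqP; split=> [[t p] [[/= + Dp] Yp]|[t p] [k _ [/= + [Dp Yp]]]].
    rewrite in_itv/= andbT => t0; exists (Num.truncn (t * n.+1%:R)) => //=.
    split; last by split.
    rewrite in_itv/= ler_pdivrMr// ltr_pdivlMr//.
    by rewrite truncn_itv// mulr_ge0.
  rewrite in_itv/= ler_pdivrMr// ltr_pdivlMr// => tk; split.
    split=> //=; rewrite in_itv/= andbT.
    have /andP[kt _] := tk.
    by rewrite -(pmulr_lge0 _ n0) (le_trans _ kt).
  by rewrite /y_step/= /step (truncn_def tk).
apply: bigcup_measurable => k _; apply: measurableX => //.
by apply: my => //; rewrite divr_ge0.
Qed.

(** By continuity in time, [y] is on [E] the pointwise limit of the functions [y_step n]. *)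
Lemma measurable_caratheodory :
  measurable_fun setT ((fun z : measurableTypeR R * T => y z.1 z.2) \_ E).
Proof.
have mE : measurable E by exact: measurableX.
apply/(measurable_restrictT _ mE).
apply: (measurable_fun_cvg measurable_y_step) => -[t p] [/= + Dp].
rewrite in_itv/= andbT => t0.
apply/cvgrPdist_lt => e e0; have [r r0 yr] := cy Dp t0 e0.
near=> n; apply: yr => //; apply: le_lt_trans (stepB n t0) _.
by near: n; exact: near_infty_natSinv_lt (PosNum r0).
Unshelve. all: by end_near. Qed.

End caratheodory.

(** * Continuity of the output in time *)

Section output_continuity.
Context (R : realType) (n : nat).

Lemma continuous_mulmx00 (C : 'rV[R]_n) :
  continuous (fun v : 'cV[R]_n => (C *m v) ord0 ord0).
Proof.
have -> : (fun v : 'cV[R]_n => (C *m v) ord0 ord0) =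
    (fun v => \sum_(i < n) C ord0 i * v i ord0).
  by apply/funext => v; rewrite mxE.
apply: (continuous_big (op := +%R)) => [|i _ v]; first exact: add_continuous.
by apply: continuousM; [exact: cst_continuous|exact: coord_continuous].
Qed.

(** For the linear functional [L], the increment of [L x] is [h] times [L] of the difference
    quotient, hence tends to [0 * L dx = 0]. *)
Lemma time_derivative_continuous (x : R -> 'cV[R]_n) (t : R) (dx : 'cV[R]_n)
    (C : 'rV[R]_n) : has_time_derivative x t dx ->
  forall e : R, 0 < e ->
  exists2 r : R, 0 < r & forall s : R, 0 <= s -> `|t - s| < r ->
    `|(C *m x t) ord0 ord0 - (C *m x s) ord0 ord0| < e.
Proof.
move=> xdx e e0; pose L (v : 'cV[R]_n) : R := (C *m v) ord0 ord0.
pose F := within [set h | 0 <= t + h] (dnbhs (0 : R)).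
have FF : Filter F by exact: within_filter.
have h0 : h @[h --> F] --> (0 : R).
  by apply: cvg_within_filter; exact: cvg_within.
have Ldx : L (h^-1 *: (x (t + h) - x t)) @[h --> F] --> L dx.
  exact: (cvg_comp _ _ xdx (continuous_mulmx00 (C := C) (x := dx))).
have : h * L (h^-1 *: (x (t + h) - x t)) @[h --> F] --> (0 : R).
  by rewrite -[X in _ --> X](mul0r (L dx)); exact: cvgM.
move=> /cvgrPdist_lt/(_ e e0); rewrite /F /within/= => /nbhs_ballP[r /= r0 hr].
(* The filter is punctured, so [s = t] is treated apart; otherwise [h = s - t]. *)
exists r => // s s0 tsr; have [->|ts] := eqVneq s t.
  by rewrite subrr normr0.
have st0 : s - t != 0 by rewrite subr_eq0.
have := hr (s - t); rewrite /ball/= sub0r opprB => /(_ tsr st0).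
rewrite [t + (s - t)]addrC subrK => /(_ s0).
by rewrite /L -scalemxAr mxE mulVKf// sub0r normrN mulmxBr !mxE distrC.
Qed.

End output_continuity.

(** * Orthonormal expansions *)

Section inner_product.
Context (R : realType) (q : nat) (Pi : set (Rpoint R q)) (rho : Rpoint R q -> R).
Hypotheses (mPi : measurable Pi) (mrho : measurable_fun Pi rho)
  (rho0 : forall p, Pi p -> 0 <= rho p).
Implicit Types f g h : Rpoint R q -> R.
Local Notation la := (lebesgue_tuple R q).
Local Notation in_L2 := (in_L2 Pi rho).
Local Notation inner := (inner Pi rho).

(** Domination by [|f g| <= f^2 + g^2], weighted by [rho >= 0]. *)
Lemma integrable_inner f g : in_L2 f -> in_L2 g ->
  la.-integrable Pi (EFin \o (fun p => f p * g p * rho p)).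
Proof.
have sq f' : in_L2 f' -> la.-integrable Pi (EFin \o (fun p => f' p ^+ 2 * rho p)).
  move=> [mf f2]; apply/integrableP; split.
    apply/measurable_EFinP; apply: measurable_funM => //.
    exact: measurable_funX.
  rewrite (le_lt_trans _ f2)// /sq_norm le_eqVlt; apply/orP; left; apply/eqP.
  apply: eq_integral => p /[!inE] Pip /=.
  by rewrite ger0_norm// mulr_ge0 ?sqr_ge0// rho0.
move=> fL gL; have [mf _] := fL; have [mg _] := gL.
apply: (le_integrable mPi _ _ (integrableD mPi (sq _ fL) (sq _ gL))).
  by apply/measurable_EFinP; do 2 apply: measurable_funM => //.
move=> p Pip /=; have r0 := rho0 Pip.
rewrite lee_fin -mulrDl !normrM (ger0_norm r0) ler_wpM2r//.
rewrite [leRHS]ger0_norm ?addr_ge0 ?sqr_ge0//.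
rewrite -[f p ^+ 2]real_normK ?num_real// -[g p ^+ 2]real_normK ?num_real//.
have := sqr_ge0 (`|f p| - `|g p|); have := normr_ge0 (f p).
by have := normr_ge0 (g p); nra.
Qed.

Lemma innerC f g : inner f g = inner g f.
Proof. by apply: eq_Rintegral => p _; rewrite [f p * _]mulrC. Qed.

Lemma innerDl f g h : in_L2 f -> in_L2 g -> in_L2 h ->
  inner (fun p => f p + g p) h = inner f h + inner g h.
Proof.
move=> fL gL hL; rewrite -RintegralD//; [|exact: integrable_inner..].
by apply: eq_Rintegral => p _; rewrite !mulrDl.
Qed.

Lemma innerZl c f g : in_L2 f -> in_L2 g ->
  inner (fun p => c * f p) g = c * inner f g.
Proof.
move=> fL gL; rewrite -RintegralZl//; last exact: integrable_inner.
by apply: eq_Rintegral => p _; rewrite !mulrA.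
Qed.

Lemma sq_normE f : in_L2 f -> sq_norm Pi rho f = (inner f f)%:E.
Proof.
by move=> fL; rewrite fineK//; apply: integrable_fin_num => //; exact: integrable_inner.
Qed.

Lemma in_L2Z c f : in_L2 f -> in_L2 (fun p => c * f p).
Proof.
move=> fL; have [mf _] := fL; split; first exact: measurable_funM.
rewrite /sq_norm.
have := integrable_lty mPi (integrableZl mPi (c ^+ 2) (integrable_inner fL fL)).
congr (_ < _)%E.
by apply: eq_integral => p _; rewrite /= -!EFinM; congr EFin; ring.
Qed.

Lemma in_L2D f g : in_L2 f -> in_L2 g -> in_L2 (fun p => f p + g p).
Proof.
move=> fL gL; have [mf _] := fL; have [mg _] := gL.
split; first exact: measurable_funD.
have ff := integrable_inner fL fL; have gg := integrable_inner gL gL.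
have fg := integrable_inner fL gL.
have i1 := integrableD mPi (integrableD mPi ff gg) (integrableD mPi fg fg).
have := integrable_lty mPi i1; congr (_ < _)%E.
by apply: eq_integral => p _; rewrite /= -!EFinD; congr EFin; ring.
Qed.

Lemma in_L2_0 : in_L2 (fun=> 0).
Proof.
split=> //; rewrite /sq_norm integral0_eq ?ltry// => p _.
by rewrite expr0n/= mul0r.
Qed.

Lemma in_L2_sum (I : Type) (s : seq I) (Q : pred I) (F : I -> Rpoint R q -> R) :
  (forall i, in_L2 (F i)) -> in_L2 (fun p => \sum_(i <- s | Q i) F i p).
Proof.
move=> FL; elim: s => [|i s IH].
  have -> : (fun p => \sum_(i <- [::] | Q i) F i p) = (fun=> 0).
    by apply/funext => p; rewrite big_nil.
  exact: in_L2_0.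
have -> : (fun p => \sum_(j <- i :: s | Q j) F j p) =
    (fun p => if Q i then F i p + \sum_(j <- s | Q j) F j p
              else \sum_(j <- s | Q j) F j p).
  by apply/funext => p; rewrite big_cons.
by case: (Q i) => //; exact: in_L2D.
Qed.

Lemma inner0l g : inner (fun=> 0) g = 0.
Proof.
rewrite /inner /Rintegral integral0_eq// => p _; by rewrite !mul0r.
Qed.

Lemma inner_suml (I : Type) (s : seq I) (Q : pred I)
    (F : I -> Rpoint R q -> R) g :
  (forall i, in_L2 (F i)) -> in_L2 g ->
  inner (fun p => \sum_(i <- s | Q i) F i p) g =
  \sum_(i <- s | Q i) inner (F i) g.
Proof.
move=> FL gL; elim: s => [|i s IH].
  have -> : (fun p => \sum_(i <- [::] | Q i) F i p) = (fun=> 0).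
    by apply/funext => p; rewrite big_nil.
  by rewrite big_nil inner0l.
have -> : (fun p => \sum_(j <- i :: s | Q j) F j p) =
    (fun p => if Q i then F i p + \sum_(j <- s | Q j) F j p
              else \sum_(j <- s | Q j) F j p).
  by apply/funext => p; rewrite big_cons.
rewrite big_cons; case: (Q i) => //.
by rewrite innerDl//; [rewrite IH|exact: in_L2_sum].
Qed.

(** Bessel's identity: for the partial sum [s], both [<s, f>] and [<s, s>] equal the sum of the
    squared coefficients. The predicate [Q] allows it to be applied to the full partial sum and to
    its part constant in b. *)
Lemma sq_norm_sub_projection (Phi : nat -> Rpoint R q -> R) f (N : nat)
    (Q : pred nat) :
  (forall i, in_L2 (Phi i)) ->
  (forall i k, inner (Phi i) (Phi k) = (i == k)%:R) -> in_L2 f ->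
  sq_norm Pi rho (fun p => f p - \sum_(i < N | Q i) inner f (Phi i) * Phi i p) =
  (inner f f - \sum_(i < N | Q i) inner f (Phi i) ^+ 2)%:E.
Proof.
move=> PL PO fL; pose w i := inner f (Phi i).
pose s p := \sum_(i < N | Q i) w i * Phi i p.
have sL : in_L2 s by apply: in_L2_sum => i; exact: in_L2Z.
have mL : in_L2 (fun p => - 1 * s p) by exact: in_L2Z.
have -> : (fun p => f p - \sum_(i < N | Q i) inner f (Phi i) * Phi i p) =
    (fun p => f p + - 1 * s p) by apply/funext => p; rewrite mulN1r.
have dL := in_L2D fL mL.
have sf : inner s f = \sum_(i < N | Q i) w i ^+ 2.
  rewrite inner_suml//; last by move=> i; exact: in_L2Z.
  by apply: eq_bigr => i _; rewrite innerZl// innerC.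
have sPhi k : inner s (Phi k) = \sum_(i < N | Q i) w i * (i == k :> nat)%:R.
  rewrite inner_suml//; last by move=> i; exact: in_L2Z.
  by apply: eq_bigr => i _; rewrite innerZl// PO.
have ss : inner s s = \sum_(i < N | Q i) w i ^+ 2.
  rewrite {1}/s inner_suml//; last by move=> i; exact: in_L2Z.
  (* Orthonormality leaves only the term [k = i]. *)
  apply: eq_bigr => i Qi; rewrite innerZl// innerC sPhi (bigD1 i)//= eqxx mulr1.
  rewrite big1 ?addr0// => k /andP[_ ki].
  by rewrite (_ : _ == _ = false) ?mulr0//; apply/negbTE.
rewrite sq_normE// innerDl// innerZl// [inner f _]innerC [inner s _]innerC.
rewrite !innerDl// !innerZl// sf ss [inner f s]innerC sf.
by congr EFin; ring.
Qed.

End inner_product.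

(** * Freezing the variables b *)

Section constant_in_b.
Context (R : realType) (q1 q2 : nat) (f : Rpoint R (q1 + q2) -> R).
Hypothesis f_const : forall j : 'I_q2, ~ nonconstant_in f (rshift q1 j).

(** The coordinates of [b'] are replaced by those of [b] one at a time: [mix k] has the first [k]
    from [b] and the others from [b']. *)
Lemma constant_join a b b' : f (join_parts a b) = f (join_parts a b').
Proof.
have fE j p r : f (set_coord p (rshift q1 j) r) = f p.
  by apply: contrapT => fne; apply: (f_const (j := j)); exists p, r.
pose mix k : Rpoint R q2 := [tuple if (i < k)%N then tnth b i else tnth b' i | i < q2].
have mixE k : (k <= q2)%N -> f (join_parts a (mix k)) = f (join_parts a b').
  elim: k => [_|k IH kq].
    by congr (f (join_parts a _)); apply: eq_from_tnth => i; rewrite tnth_mktuple.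
  (* [mix k.+1] is [mix k] with coordinate [k] reset to its value in [b]. *)
  rewrite -(IH (ltnW kq)) -(fE (Ordinal kq) (join_parts a (mix k)) (tnth b (Ordinal kq))).
  congr f; apply: eq_from_tnth => i; rewrite tnth_mktuple.
  case: (split_ordP i) => j ->.
    by rewrite !tnth_join_lshift eq_lrshift.
  rewrite !tnth_join_rshift !tnth_mktuple (inj_eq (@rshift_inj _ _)) ltnS leq_eqVlt.
  by have [->|/eqP jk] := eqVneq j (Ordinal kq); rewrite ?eqxx//; case: eqP => // jk';
    case: jk; apply: val_inj.
rewrite -(mixE q2 (leqnn _)); congr (f (join_parts a _)).
by apply: eq_from_tnth => i; rewrite tnth_mktuple ltn_ord.
Qed.

End constant_in_b.

(** * From the chaos expansion to the bound by partial variances *)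

Section chaos.
Context (R : realType) (q1 q2 : nat).
Variables (Pia : set (Rpoint R q1)) (Pib : set (Rpoint R q2)).
Hypotheses (mPia : measurable Pia) (mPib : measurable Pib).
Local Notation Pi := (domain_prod Pia Pib).
Variable rho : Rpoint R (q1 + q2) -> R.
Hypotheses (mrho : measurable_fun Pi rho) (rho0 : forall p, Pi p -> 0 <= rho p).
Variable P : probability (Rpoint R (q1 + q2)) R.
Hypotheses (PE : forall A, prob Pi rho A = P A)
  (integral_P : forall g : Rpoint R (q1 + q2) -> \bar R,
    measurable_fun setT g -> (forall p, 0 <= g p)%E ->
    (\int[P]_p g p = \int[lebesgue_tuple R (q1 + q2)]_(p in Pi) (g p * (rho p)%:E))%E)
  (P_rectangle : forall A : 'I_(q1 + q2) -> set (measurableTypeR R),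
    (forall j, measurable (A j)) ->
    P (rectangle A) = (\prod_j P [set p | A j (tnth p j)])%E).
Variable y : R -> Rpoint R (q1 + q2) -> R.
Hypothesis y_L2 : forall t : R, 0 <= t -> in_L2 Pi rho (y t).
Hypothesis y_cont : forall p, Pi p -> forall t : R, 0 <= t ->
  forall e : R, 0 < e ->
  exists2 r : R, 0 < r &
    forall s : R, 0 <= s -> `|t - s| < r -> `|y t p - y s p| < e.
Variable Phi : nat -> Rpoint R (q1 + q2) -> R.
Hypothesis Phi_on : complete_orthonormal Pi rho Phi.

Local Notation la := (lebesgue_tuple R (q1 + q2)).
Local Notation Pa := (law_a P).
Local Notation Pb := (law_b P).

Lemma measurable_domain_prod : measurable Pi.
Proof.
have -> : Pi = @a_part R q1 q2 @^-1` Pia `&` @b_part R q1 q2 @^-1` Pib by [].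
apply: measurableI; rewrite -[X in measurable X]setTI.
  exact: measurable_a_part.
exact: measurable_b_part.
Qed.
Let mPi := measurable_domain_prod.

Let Y : measurableTypeR R * Rpoint R (q1 + q2) -> R :=
  (fun z => y z.1 z.2) \_ (`[0, +oo[ `*` Pi).

Let mY : measurable_fun setT Y.
Proof.
apply: measurable_caratheodory => //.
by move=> t /y_L2[].
Qed.

Let YE t p : 0 <= t -> Pi p -> Y (t, p) = y t p.
Proof.
by move=> t0 Pip; rewrite /Y patchE mem_set//; split=> //=; rewrite in_itv/= t0.
Qed.

Let Y_lt0 t p : t < 0 -> Y (t, p) = 0.
Proof.
move=> t0; rewrite /Y patchE memNset// => -[/=].
by rewrite in_itv/= andbT leNgt t0.
Qed.

Let Y_out t p : ~ Pi p -> Y (t, p) = 0.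
Proof. by move=> Pip; rewrite /Y patchE memNset// => -[]. Qed.

(** The arguments are regrouped as ((t, a), b), so that (t, a) is the variable kept and b the one
    frozen. *)
Let F (z : (measurableTypeR R * Rpoint R q1) * Rpoint R q2) : R :=
  Y (z.1.1, join_parts z.1.2 z.2).

Let mF : measurable_fun setT F.
Proof.
apply: (measurableT_comp mY); apply/measurable_fun_pairP; split => /=.
  by apply: (@measurableT_comp _ _ _ _ _ _ fst _ fst).
apply: (@measurableT_comp _ _ _ _ _ _
  (fun z : Rpoint R q1 * Rpoint R q2 => join_parts z.1 z.2) _
  (fun z => (z.1.2, z.2))); first exact: measurable_join_parts.
apply/measurable_fun_pairP; split => //=.
  by apply: (@measurableT_comp _ _ _ _ _ _ snd _ fst).
exact: measurable_snd.
Qed.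

Let law_b_out : Pb (~` Pib) = 0%E.
Proof.
have : Pb (~` Pib) = prob Pi rho (@b_part R q1 q2 @^-1` (~` Pib)) by rewrite PE.
rewrite /prob (_ : _ `&` _ = set0) ?integral_set0//.
by apply/seteqP; split=> // p [[_ h] /= /(_ h)].
Qed.

(** Expectations over [Pi] become iterated integrals over the laws of a and b, by the product law
    and Tonelli's theorem. *)
Let integral_Pi (g : Rpoint R (q1 + q2) -> \bar R) :
  measurable_fun setT g -> (forall p, 0 <= g p)%E ->
  (\int[la]_(p in Pi) (g p * (rho p)%:E) =
   \int[Pa]_a \int[Pb]_b g (join_parts a b))%E.
Proof.
move=> mg g0; rewrite -integral_P//.
have mgj : measurable_fun setT (fun z : Rpoint R q1 * Rpoint R q2 =>
    g (join_parts z.1 z.2)).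
  by apply: (measurableT_comp mg); exact: measurable_join_parts.
rewrite -(fubini_tonelli1 (m1 := Pa) (m2 := Pb) _ mgj)//.
rewrite -(ge0_integral_parts P_rectangle mgj)//.
by apply: eq_integral => p _; rewrite /= join_parts_ab.
Qed.

(** For [b] in [Pib], freezing keeps points of [Pi] inside [Pi], where [Y] agrees with [y]; at
    negative times the integrand on the right vanishes. *)
Lemma freezing_errorE b : Pib b ->
  freezing_error Pi rho y b = frozen_sq_dev (sigma_finite_product (@lebesgue_measure R) Pa) Pb F b.
Proof.
move=> Pibb; pose G z : \bar R := ((F z - F (z.1, b)) ^+ 2)%:E.
have mG : measurable_fun setT G.
  apply/measurable_EFinP; apply: measurable_funX; apply: measurable_funB => //.
  apply: (measurableT_comp mF); apply/measurable_fun_pairP; split.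
    exact: measurable_fst.
  exact: measurable_cst.
have G0 z : (0 <= G z)%E by rewrite lee_fin sqr_ge0.
have mIG := measurable_fun_fubini_tonelli_F (m2 := Pb) G mG G0.
rewrite /frozen_sq_dev.
transitivity (\int[lebesgue_measure]_t \int[Pa]_a \int[Pb]_c G ((t, a), c))%E;
  last first.
  rewrite (ge0_integral_sigma_finite_product lebesgue_measure Pa mIG)//.
  by move=> x; apply: integral_ge0.
rewrite /freezing_error /sq_norm_time integral_mkcond; apply: eq_integral => t _.
rewrite patchE; case: ifPn => [|]; last first.
  rewrite notin_setE/= in_itv/= andbT => /negP; rewrite -ltNge => t0.
  rewrite integral0_eq// => a _; rewrite integral0_eq// => c _.
  by rewrite /G /F/= !Y_lt0// subrr expr0n.
rewrite inE/= in_itv/= andbT => t0.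
have mYt : measurable_fun setT (fun p => Y (t, p)) by exact: measurableT_comp.
have mj : measurable_fun setT (fun p : Rpoint R (q1 + q2) => (a_part p, b)).
  apply/measurable_fun_pairP; split; first exact: measurable_a_part.
  exact: measurable_cst.
have mYb := measurableT_comp mYt (measurableT_comp (@measurable_join_parts R q1 q2) mj).
rewrite /sq_norm.
transitivity (\int[la]_(p in Pi)
  (((Y (t, p) - Y (t, join_parts (a_part p) b)) ^+ 2)%:E * (rho p)%:E))%E.
  apply: eq_integral => p /[!inE] Pip; rewrite -EFinM /freeze_b.
  rewrite YE// YE//; split; first by rewrite a_part_join; have [] := Pip.
  by rewrite b_part_join.
rewrite integral_Pi//.
- apply: eq_integral => a _; apply: eq_integral => c _.
  by rewrite /G /F/= a_part_join.
- by apply/measurable_EFinP; apply: measurable_funX; exact: measurable_funB.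
- by move=> p; rewrite lee_fin sqr_ge0.
Qed.

Local Notation V j := (partial_variance Pi rho y Phi j).

Let mPhi i : measurable_fun Pi (Phi i).
Proof. by case: Phi_on => /(_ i)[]. Qed.

(** The coefficient is the parametric integral of the jointly measurable [Y] against [Phi i * rho]
    extended by zero. *)
Lemma measurable_coef i :
  measurable_fun (`[0%R, +oo[ : set R) (fun t => coef Pi rho y Phi t i).
Proof.
pose g (z : measurableTypeR R * Rpoint R (q1 + q2)) : R :=
  Y z * ((fun p => Phi i p * rho p) \_ Pi) z.2.
have mg : measurable_fun setT g.
  have mr : measurable_fun setT ((fun p => Phi i p * rho p) \_ Pi).
    by apply/(measurable_restrictT _ mPi); exact: measurable_funM.
  by apply: measurable_funM => //; exact: (measurableT_comp mr measurable_snd).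
apply: (eq_measurable_fun (fun t => \int[la]_p g (t, p))).
  move=> t; rewrite inE/= in_itv/= andbT => t0.
  rewrite /coef /inner Rintegral_mkcond; apply: eq_Rintegral => p _.
  rewrite /g /= !patchE; case: ifPn => [|_]; last by rewrite mulr0.
  by rewrite inE => Pip; rewrite YE// mulrA.
apply: measurable_funTS; exact: measurable_parametric_Rintegral.
Qed.

Lemma partial_varianceE j t : V j t =
  (\sum_(i <oo | `[< nonconstant_in (Phi i) j >]) ((coef Pi rho y Phi t i) ^+ 2)%:E)%E.
Proof.
rewrite nneseries_esum => [|i _]; last by rewrite lee_fin sqr_ge0.
by congr esum; apply/seteqP; split=> i /= /asboolP.
Qed.

Lemma partial_variance_ge0 j t : (0 <= V j t)%E.
Proof. by apply: esum_ge0 => i _; rewrite lee_fin sqr_ge0. Qed.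

Lemma measurable_partial_variance j :
  measurable_fun (`[0%R, +oo[ : set R) (V j).
Proof.
have -> : V j = (fun t => \sum_(i <oo | `[< nonconstant_in (Phi i) j >])
    ((coef Pi rho y Phi t i) ^+ 2)%:E)%E.
  by apply/funext => t; exact: partial_varianceE.
apply: ge0_emeasurable_sum => [i t _ _|i _].
  by rewrite lee_fin sqr_ge0.
by apply/measurable_EFinP; apply: measurable_funX; exact: measurable_coef.
Qed.

(** A [Phi i] that is not constant in b is non-constant in some b-coordinate, so its squared
    coefficient occurs in at least one of the partial variances on the right. *)
Lemma sum_coef_le_partial_variance t N :
  ((\sum_(i < N | ~~ `[< forall j : 'I_q2, ~ nonconstant_in (Phi i) (rshift q1 j) >])
     coef Pi rho y Phi t i ^+ 2)%:E <= \sum_(j < q2) V (rshift q1 j) t)%E.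
Proof.
pose w i := coef Pi rho y Phi t i.
apply: (@le_trans _ _ (\sum_(j < q2)
    (\sum_(i < N | `[< nonconstant_in (Phi i) (rshift q1 j) >]) w i ^+ 2)%:E)%E).
  rewrite sumEFin lee_fin (exchange_big_dep predT)//= big_mkcond/=.
  apply: ler_sum => i _; case: ifPn => [|_]; last first.
    by apply: sumr_ge0 => j _; exact: sqr_ge0.
  move/asboolPn/existsNP => [j /contrapT ij].
  rewrite (bigD1 j)/=; last exact/asboolP.
  by rewrite lerDl sumr_ge0// => k _; exact: sqr_ge0.
apply: lee_sum => j _; rewrite partial_varianceE -sumEFin.
rewrite -(big_mkord (fun i => `[< nonconstant_in (Phi i) (rshift q1 j) >])
  (fun i => (w i ^+ 2)%:E)).
by apply: nneseries_lim_ge => i _; rewrite lee_fin sqr_ge0.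
Qed.

Let M (x : measurableTypeR R * Rpoint R q1) : R := \int[Pb]_b F (x, b).

(** For fixed [a] the subtracted sum is a constant [c] in [b], and by [integral_sqrB_decomp] the
    mean square deviation is smallest about the mean. *)
Lemma sq_dev_le_sq_norm t N (Q := fun i : nat =>
    `[< forall j : 'I_q2, ~ nonconstant_in (Phi i) (rshift q1 j) >]) : 0 <= t ->
  (\int[Pa]_a \int[Pb]_b ((F ((t, a), b) - M (t, a)) ^+ 2)%:E <=
   sq_norm Pi rho (fun p => (y t p -
     \sum_(i < N | Q i) inner Pi rho (y t) (Phi i) * Phi i p)%R))%E.
Proof.
move=> t0; set g := fun p => \sum_(i < N | Q i) inner Pi rho (y t) (Phi i) * Phi i p.
pose G p : \bar R := (((fun p => y t p - g p) \_ Pi) p ^+ 2)%:E.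
have [PhiL2 _ _] := Phi_on.
have mG : measurable_fun setT G.
  apply/measurable_EFinP; apply: measurable_funX.
  apply/(measurable_restrictT _ mPi); apply: measurable_funB.
    by have [] := y_L2 t0.
  have gL : in_L2 Pi rho g by apply: in_L2_sum => // i; exact: in_L2Z.
  by have [] := gL.
have G0 p : (0 <= G p)%E by rewrite lee_fin sqr_ge0.
have mGj : measurable_fun setT (fun z : Rpoint R q1 * Rpoint R q2 =>
    G (join_parts z.1 z.2)).
  exact: (measurableT_comp mG (@measurable_join_parts R q1 q2)).
have mFM : measurable_fun setT (fun z : Rpoint R q1 * Rpoint R q2 =>
    ((F ((t, z.1), z.2) - M (t, z.1)) ^+ 2)%:E).
  apply/measurable_EFinP; apply: measurable_funX.
  have mt : measurable_fun setT (fun z : Rpoint R q1 * Rpoint R q2 => (t, z.1)).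
    by apply/measurable_fun_pairP; split; [exact: measurable_cst|exact: measurable_fst].
  apply: measurable_funB.
    apply: (measurableT_comp mF); apply/measurable_fun_pairP; split => //.
    exact: measurable_snd.
  apply: (measurableT_comp _ mt).
  exact: measurable_parametric_Rintegral.
rewrite [leRHS](_ : _ = \int[Pa]_a \int[Pb]_b G (join_parts a b))%E; last first.
  rewrite -integral_Pi//; apply: eq_integral => p pPi.
  by rewrite /G patchE pPi -EFinM.
apply: ge0_le_integral => //.
- by move=> a _; apply: integral_ge0 => b _; rewrite lee_fin sqr_ge0.
- by apply: (measurable_fun_fubini_tonelli_F _ mFM) => z; rewrite lee_fin sqr_ge0.
- exact: (measurable_fun_fubini_tonelli_F _ mGj).
(* For [a] outside [Pia], [F] and hence [M] vanish, so the left side is 0. *)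
move=> a _; have [Piaa|Piaa] := pselect (Pia a); last first.
  have F0 b : F ((t, a), b) = 0.
    by rewrite /F/= Y_out// => -[+ _]; rewrite a_part_join.
  rewrite integral0_eq ?integral_ge0// => b _.
  rewrite F0 /M /Rintegral integral0_eq ?subr0 ?expr0n// => c _.
  by rewrite F0.
(* An arbitrary reference point. *)
pose b0 : Rpoint R q2 := [tuple 0 | i < q2].
pose c := g (join_parts a b0).
have gc b : g (join_parts a b) = c.
  by apply: eq_bigr => i /asboolP Qi; rewrite (constant_join Qi a b b0).
have mFa : measurable_fun setT (fun b => F ((t, a), b)) by exact: measurableT_comp.
have mFc : measurable_fun setT (fun b => ((F ((t, a), b) - c) ^+ 2)%:E).
  exact: measurable_sqrB.
apply: (@le_trans _ _ (\int[Pb]_b ((F ((t, a), b) - c) ^+ 2)%:E)%E).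
  by rewrite [leRHS](integral_sqrB_decomp Pb mFa) leeDl// lee_fin sqr_ge0.
have mGa : measurable_fun setT (fun b => G (join_parts a b)).
  have mab : measurable_fun setT (fun b : Rpoint R q2 => (a, b)).
    by apply/measurable_fun_pairP; split; [exact: measurable_cst|exact: measurable_id].
  exact: (measurableT_comp mGj mab).
(* Outside [Pib] the integrands may differ, [G] being cut off there, but the law of b gives this set
   no mass. *)
have mCPib : measurable (~` Pib) by exact: measurableC.
rewrite (ge0_negligible_integral mCPib)//; last by move=> b _; rewrite lee_fin sqr_ge0.
rewrite [leRHS](ge0_negligible_integral mCPib)//.
rewrite le_eqVlt; apply/orP; left; apply/eqP; apply: eq_integral => b.
rewrite inE => -[_ /contrapT Pibb].
have Pij : Pi (join_parts a b) by split; rewrite ?a_part_join ?b_part_join.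
by rewrite /G patchE mem_set// /F/= YE// gc.
Qed.

(** The bound [I <= e N + W] holds for every [N], and [e N] tends to 0 by completeness. *)
Lemma sq_dev_le_partial_variances t : 0 <= t ->
  (\int[Pa]_a \int[Pb]_b ((F ((t, a), b) - M (t, a)) ^+ 2)%:E <=
   \sum_(j < q2) V (rshift q1 j) t)%E.
Proof.
move=> t0; set I := (\int[Pa]_a _)%E; set W := (\sum_(j < q2) _)%E.
have [PhiL2 PhiO Phi_complete] := Phi_on.
have yL2 := y_L2 t0.
pose e N := sq_norm Pi rho (fun p => y t p -
  \sum_(i < N) inner Pi rho (y t) (Phi i) * Phi i p).
have le N : (I <= e N + W)%E.
  apply: (le_trans (sq_dev_le_sq_norm N t0)).
  apply: le_trans (leeD2l _ (sum_coef_le_partial_variance t N)).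
  (* Bessel's identity is used twice, for all [i < N] and for those constant in b; the two errors
     differ by the sum over the remaining indices. *)
  have -> : e N = (inner Pi rho (y t) (y t) -
      \sum_(i < N) inner Pi rho (y t) (Phi i) ^+ 2)%:E.
    exact: (sq_norm_sub_projection mPi mrho rho0 N predT).
  have qE := sq_norm_sub_projection mPi mrho rho0 N (fun i =>
    `[< forall j : 'I_q2, ~ nonconstant_in (Phi i) (rshift q1 j) >])
    PhiL2 PhiO yL2.
  rewrite [leLHS]qE -EFinD lee_fin le_eqVlt.
  apply/orP; left; apply/eqP; rewrite [in RHS](bigID (fun i : 'I_N =>
    `[< forall j : 'I_q2, ~ nonconstant_in (Phi i) (rshift q1 j) >]))/=.
  by rewrite /coef; ring.
(* [W] may be infinite; the limit of the sum is still defined because the other limit, 0, is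
   finite. *)
have cvge : (e N + W)%E @[N --> \oo] --> (0 + W)%E.
  apply: cvgeD; [|exact: Phi_complete|exact: cvg_cst].
  by rewrite fin_num_adde_defr.
rewrite -[W]add0e -(cvg_lim _ cvge)//; apply: lime_ge.
  by apply/cvg_ex; exists (0 + W)%E.
exact: nearW.
Qed.

Lemma mean_sq_dev_le_sum_b_variances :
  (mean_sq_dev (sigma_finite_product (@lebesgue_measure R) Pa) Pb F <=
   sum_b_variances Pi rho y Phi)%E.
Proof.
pose G z : \bar R := ((F z - M z.1) ^+ 2)%:E.
have mG : measurable_fun setT G.
  apply/measurable_EFinP; apply: measurable_funX; apply: measurable_funB => //.
  apply: (measurableT_comp _ measurable_fst).
  exact: measurable_parametric_Rintegral.
have G0 z : (0 <= G z)%E by rewrite lee_fin sqr_ge0.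
have mIG := measurable_fun_fubini_tonelli_F (m2 := Pb) G mG G0.
have IG0 x : (0 <= \int[Pb]_b G (x, b))%E by exact: integral_ge0.
have -> : mean_sq_dev (sigma_finite_product (@lebesgue_measure R) Pa) Pb F =
    (\int[lebesgue_measure]_t \int[Pa]_a \int[Pb]_b G ((t, a), b))%E.
  exact: (ge0_integral_sigma_finite_product lebesgue_measure Pa mIG).
have mIIG := measurable_fun_fubini_tonelli_F (m2 := Pa) _ mIG IG0.
have -> : sum_b_variances Pi rho y Phi =
    (\int[lebesgue_measure]_(t in `[0%R, +oo[) \sum_(j < q2) V (rshift q1 j) t)%E.
  rewrite ge0_integral_sum//.
  - apply: eq_bigr => j _; rewrite /L1_norm_time; apply: eq_integral => t _.
    by rewrite gee0_abs// partial_variance_ge0.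
  - by move=> j; exact: measurable_partial_variance.
  - by move=> j t _; exact: partial_variance_ge0.
(* The extension by zero removes the negative times, and the pointwise bound is then integrated over
   the half-line. *)
rewrite [leLHS](_ : _ = \int[lebesgue_measure]_(t in `[0%R, +oo[)
    \int[Pa]_a \int[Pb]_b G ((t, a), b))%E.
  apply: ge0_le_integral => //.
  - by move=> t _; apply: integral_ge0.
  - exact: measurable_funTS.
  - by apply: emeasurable_sum => j; exact: measurable_partial_variance.
  - move=> t /=; rewrite in_itv/= andbT; exact: sq_dev_le_partial_variances.
rewrite [RHS]integral_mkcond; apply: eq_integral => t _.
rewrite patchE; case: ifPn => //; rewrite notin_setE/= in_itv/= andbT => /negP.
rewrite -ltNge => t0; rewrite integral0_eq// => a _; rewrite integral0_eq// => b _.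
have F0 c : F ((t, a), c) = 0 by rewrite /F/= Y_lt0.
rewrite /G/= F0 /M /Rintegral integral0_eq ?subr0 ?expr0n// => c _.
by rewrite F0.
Qed.

Lemma exists_freezing_set (delta : R) : 0 < delta -> delta < 1 ->
  let S := sum_b_variances Pi rho y Phi in
  let bound := ((1 + delta^-1)%:E * S)%E in
  let err := freezing_error Pi rho y in
  exists B : set (Rpoint R q2),
    [/\ measurable B, B `<=` Pib, ((1 - delta)%:E < prob_b Pi rho B)%E &
        forall b, B b ->
          (err b <= bound)%E /\
          ((0 < S)%E -> (S < +oo)%E ->
           prob_b Pi rho [set b | Pib b /\ err b = bound] <> delta%:E ->
           (err b < bound)%E)].
Proof.
move=> d0 d1 S bound err.
have prob_bE A : prob_b Pi rho A = Pb A by rewrite /prob_b PE.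
(* [prob_b] integrates over [Pi], so it sees a set only through its trace on [Pib]; intersecting [B]
   with [Pib] costs no probability. *)
have eq_prob_b A A' : (forall b, Pib b -> A b <-> A' b) ->
    prob_b Pi rho A = prob_b Pi rho A'.
  move=> AA'; rewrite /prob_b /prob; congr (integral _ _ _).
  by apply/seteqP; split=> p /= [[pa pb] /(AA' _ pb)].
have [B [mB PB HB]] := exists_frozen_set mF d0 d1 mean_sq_dev_le_sum_b_variances.
exists (Pib `&` B); split.
- exact: measurableI.
- by move=> b [].
- rewrite (_ : prob_b Pi rho _ = Pb B)// -prob_bE; apply: eq_prob_b => b Pibb.
  by split=> [[]|].
move=> b [Pibb Bb]; have [h1 h2] := HB b Bb.
rewrite /err freezing_errorE//; split=> // S0 Soo Hd; apply: h2 => // PbE; apply: Hd.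
rewrite -PbE -prob_bE; apply: eq_prob_b => c Pibc /=.
by rewrite /err freezing_errorE//; split=> [[]|].
Qed.

End chaos.

(** Strictness is conditional: for [S = 0] it would read [err bbar < 0], and if [{err = bound}] has
    probability [delta], every set of probability larger than [1 - delta] meets it. *)
Theorem theorem1 (R : realType) (q1 q2 n nin : nat)
    (Pia : set (Rpoint R q1)) (Pib : set (Rpoint R q2))
    (mPia : measurable Pia) (mPib : measurable Pib)
    (Pi : set (Rpoint R (q1 + q2))) (PiE : Pi = domain_prod Pia Pib)
    (E A : Rpoint R (q1 + q2) -> 'M[R]_n)
    (B : Rpoint R (q1 + q2) -> 'M[R]_(n, nin))
    (C : Rpoint R (q1 + q2) -> 'rV[R]_n)
    (x0 : Rpoint R (q1 + q2) -> 'cV[R]_n)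
    (cE : continuous_on Pi E) (cA : continuous_on Pi A)
    (cB : continuous_on Pi B) (cC : continuous_on Pi C)
    (cx0 : continuous_on Pi x0)
    (E_unit : forall p, Pi p -> E p \in unitmx)
    (EA_stable : forall p, Pi p -> asymptotically_stable (E p) (A p))
    (u : R -> 'cV[R]_nin)
    (x : R -> Rpoint R (q1 + q2) -> 'cV[R]_n)
    (x_sol : forall p, Pi p ->
       is_solution (E p) (A p) (B p) u (x0 p) (fun t => x t p))
    (y : R -> Rpoint R (q1 + q2) -> R)
    (yE : forall (t : R) p, 0 <= t -> Pi p -> y t p = (C p *m x t p) ord0 ord0)
    (rho : Rpoint R (q1 + q2) -> R)
    (rho_density : is_density Pi rho)
    (p_indep : independent_coordinates Pi rho)
    (y_L2 : forall t : R, 0 <= t -> in_L2 Pi rho (y t))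
    (Phi : nat -> Rpoint R (q1 + q2) -> R)
    (Phi_chaos : polynomial_chaos Pi rho Phi)
    (V_gt0 : forall t : R, 0 < t -> (0 < total_variance Pi rho y Phi t)%E)
    (delta : R) (delta_gt0 : 0 < delta) (delta_lt1 : delta < 1) :
  let S := sum_b_variances Pi rho y Phi in
  let bound := ((1 + delta^-1)%:E * S)%E in
  let err := freezing_error Pi rho y in
  exists Bdelta : set (Rpoint R q2),
    [/\ measurable Bdelta, Bdelta `<=` Pib,
        ((1 - delta)%:E < prob_b Pi rho Bdelta)%E &
        forall bbar, Bdelta bbar ->
          (err bbar <= bound)%E /\
          ((0 < S)%E -> (S < +oo)%E ->
           prob_b Pi rho [set b | Pib b /\ err b = bound] <> delta%:E ->
           (err bbar < bound)%E)].
Proof.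
have mPi : measurable Pi by rewrite PiE; exact: measurable_domain_prod.
have [mrho rho0 rho1] := rho_density.
have [P PE intP] := is_density_probability mPi rho_density.
have P_rectangle (D : 'I_(q1 + q2) -> set (measurableTypeR R)) :
    (forall j, measurable (D j)) ->
    P (rectangle D) = (\prod_j P [set p | D j (tnth p j)])%E.
  (* Independence for the set of all coordinates is the product formula on boxes. *)
  move=> mD; have := p_indep [set: 'I_(q1 + q2)]%SET D mD.
  under eq_bigr do rewrite PE.
  rewrite PE (_ : [set p | _] = rectangle D) => [->|].
    by apply: eq_bigl => j; rewrite finset.in_setT.
  by apply/seteqP; split=> p h j; [exact: (h j (finset.in_setT j))|move=> _; exact: h].
have y_cont p : Pi p -> forall t : R, 0 <= t -> forall e : R, 0 < e ->
    exists2 r : R, 0 < r &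
      forall s : R, 0 <= s -> `|t - s| < r -> `|y t p - y s p| < e.
  (* A solution is differentiable in time, so the output is continuous in time. *)
  move=> Pip t t0 e e0; have [_ /(_ t t0)[dx xdx _]] := x_sol p Pip.
  have [r r0 xr] := time_derivative_continuous (C p) xdx e0.
  by exists r => // s s0 ts; rewrite !yE//; exact: xr.
have [Phi_on _] := Phi_chaos.
subst Pi; exact: (exists_freezing_set mPia mPib mrho rho0 PE intP P_rectangle
  y_L2 y_cont Phi_on delta_gt0 delta_lt1).
Qed.
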